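(* Let $(R,\mathfrak m)$ be a commutative Noetherian Gorenstein local ring of dimension $d$ and let $M$ be a maximal Cohen-Macaulay $R$-module. Assume that $\mathrm{NF}(M)\subseteq W_1$, where $W_1=\{\mathfrak p\in\mathrm{Spec}(R):\dim R/\mathfrak p\leqq 1\}$. Assume furthermore that $$\mathrm{depth}\;\underline{\mathrm{Hom}}_R(M,M[d-1])>0\quad\text{and}\quad\mathrm{depth}\;\underline{\mathrm{Hom}}_R(M,M[d-2])>1.$$ Then $M$ is a free $R$-module.
   Context: For a finitely generated $R$-module $M$, $\mathrm{NF}(M)=\{\mathfrak p\in\mathrm{Spec}(R): M_{\mathfrak p}\text{ is not }R_{\mathfrak p}\text{-free}\}$. $\underline{\mathrm{Hom}}_R(M,N)$ is the quotient of $\mathrm{Hom}_R(M,N)$ by the submodule of homomorphisms factoring through a free module. Since $R$ is Gorenstein, the syzygy functor $\Omega$ is an auto-equivalence of the stable category $\underline{\mathrm{CM}}(R)$ of maximal Cohen-Macaulay modules (objects: maximal Cohen-Macaulay modules; morphisms: $\underline{\mathrm{Hom}}_R$), which is a triangulated category with shift $[1]=\Omega^{-1}$; $M[j]$ denotes the $j$-th shift of $M$, $j\in\mathbb Z$ (so $\underline{\mathrm{Hom}}_R(M,N[j])\cong\mathrm{Ext}^j_R(M,N)$ for $j>0$). By convention the depth of the zero module is $+\infty$. *)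

(* Defs.v *)
From HB Require Import structures.
From mathcomp Require Import all_boot all_order all_algebra.
From mathcomp Require Import boolp classical_sets.
From mathcomp Require Import ring.

Set Implicit Arguments.
Unset Strict Implicit.
Unset Printing Implicit Defensive.

Import GRing.Theory.
Local Open Scope ring_scope.
Local Open Scope quotient_scope.

(* Extended natural numbers; [None] is +oo. *)
Definition enat := option nat.

Definition enat_le (x y : enat) : Prop :=
  match x, y with
  | _, None => True
  | None, Some _ => False
  | Some a, Some b => (a <= b)%N
  end.

Definition enat_lt (x y : enat) : Prop := enat_le x y /\ x <> y.

Definition enat_sup (P : set nat) : enat :=
  match pselect (exists b, `[< forall n, P n -> (n <= b)%N >]) with
  | left ex => Some (ex_minn ex)
  | right _ => None
  end.

Lemma enat_supP (P : set nat) (y : enat) :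
  enat_le (enat_sup P) y <-> (forall n, P n -> enat_le (Some n) y).
Proof.
rewrite /enat_sup; case: pselect => [ex | nex].
  case: ex_minnP => b /asboolP bub bmin; case: y => [y|] //=.
  split=> [le_by n Pn | yub]; first exact: leq_trans (bub n Pn) le_by.
  by apply: bmin; apply/asboolP.
case: y => [y|] //=; split=> // yub.
by apply: nex; exists y; apply/asboolP.
Qed.

Section Modules.
Variable R : comNzRingType.
Implicit Types M N : lmodType R.

Definition fin_gen M : Prop :=
  exists n (g : 'I_n -> M), forall x,
    exists c : 'I_n -> R, x = \sum_i c i *: g i.

(* Free of finite rank, which for a finitely generated module is the same as
   free. It is also enough for maps factoring through a free module: the image
   of a finitely generated module lies in a summand of finite rank. *)
Definition is_free M : Prop :=
  exists n (f : {linear 'rV[R]_n -> M}), bijective f.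

Definition injective_module (E : lmodType R) : Prop :=
  forall (A B : lmodType R) (i : {linear A -> B}) (f : {linear A -> E}),
    injective i -> exists g : {linear B -> E}, forall x, g (i x) = f x.

Definition short_exact (A B C : lmodType R)
    (f : {linear A -> B}) (g : {linear B -> C}) : Prop :=
  [/\ injective f, forall y, g y = 0 <-> exists x, f x = y
    & forall z, exists y, g y = z].

(* [M] has an injective resolution 0 -> M -> E_0 -> ... -> E_n -> 0. *)
Fixpoint inj_dim_le (n : nat) (M : lmodType R) : Prop :=
  if n is n'.+1 then
    exists (E C : lmodType R) (f : {linear M -> E}) (g : {linear E -> C}),
      [/\ injective_module E, short_exact f g & inj_dim_le n' C]
  else injective_module M.

End Modules.

Section Rings.
Variable R : comNzRingType.

(* [idealr R] is the type of proper ideals; the unit ideal, which it omits, is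
   generated by 1. *)
Definition noetherian : Prop :=
  forall I : idealr R, exists n (g : 'I_n -> R), forall x,
    x \in I <-> exists c : 'I_n -> R, x = \sum_i c i * g i.

Definition maximal_ideal (m : idealr R) : Prop :=
  forall I : idealr R, {subset m <= I} -> {subset I <= m}.

Definition is_local (m : idealr R) : Prop :=
  maximal_ideal m /\ forall n : idealr R, maximal_ideal n -> n =i m.

Definition gorenstein : Prop := exists n, inj_dim_le n (R^o : lmodType R).

Definition prime_chain (n : nat) : Prop :=
  exists p : nat -> prime_idealr R, forall i, (i < n)%N ->
    {subset p i <= p i.+1} /\ ~ {subset p i.+1 <= p i}.

Definition krull_dim : enat := enat_sup prime_chain.

End Rings.

Section Depth.
Variables (R : comNzRingType) (m : idealr R) (M : lmodType R).

(* Membership in (x_0, ..., x_{k-1}) M. *)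
Definition in_ideal_mul (x : seq R) (k : nat) (y : M) : Prop :=
  exists z : 'I_k -> M, y = \sum_(i < k) x`_i *: z i.

Definition regular_seq (x : seq R) : Prop :=
  (forall (i : nat) (y : M), (i < size x)%N ->
     in_ideal_mul x i (x`_i *: y) -> in_ideal_mul x i y) /\
  exists y, ~ in_ideal_mul x (size x) y.

Definition regular_length (n : nat) : Prop :=
  exists x : seq R,
    [/\ size x = n, forall a, a \in x -> a \in m & regular_seq x].

Definition depth : enat :=
  if `[< forall y : M, y = 0 >] then None else enat_sup regular_length.

(* The zero module counts as maximal Cohen-Macaulay: it is the zero object of
   the stable category. *)
Definition MCM : Prop := fin_gen M /\ enat_le (krull_dim R) depth.

End Depth.

Definition mk_linear (R : comNzRingType) (M N : lmodType R) (f : M -> N)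
    (f_lin : linear f) : {linear M -> N} :=
  HB.pack f (GRing.isLinear.Build R M N *:%R f f_lin).

(* Hom_R(M, N) as an R-module, with the pointwise operations. *)
Section Hom.
Variables (R : comNzRingType) (M N : lmodType R).

Definition hom := {linear M -> N}.

Definition hom_fun (f : hom) : M -> N := f.

Lemma hom_ext (f g : hom) : hom_fun f =1 hom_fun g -> f = g.
Proof.
case: f => f [[f1] [f2]]; case: g => g [[g1] [g2]]; rewrite /hom_fun /= => e.
have {}e : f = g by apply/funext.
move: e f1 f2 g1 g2 => -> f1 f2 g1 g2.
by rewrite (Prop_irrelevance f1 g1) (Prop_irrelevance f2 g2).
Qed.

HB.instance Definition _ := gen_eqMixin hom.
HB.instance Definition _ := gen_choiceMixin hom.

Lemma hom0_subproof : linear (fun _ : M => 0 : N).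
Proof. by move=> a x y; rewrite scaler0 addr0. Qed.

Lemma hom_opp_subproof (f : hom) : linear (fun x => - hom_fun f x).
Proof. by move=> a x y; rewrite /hom_fun linearP opprD scalerN. Qed.

Lemma hom_add_subproof (f g : hom) : linear (fun x => hom_fun f x + hom_fun g x).
Proof. by move=> a x y; rewrite /hom_fun !linearP scalerDr addrACA. Qed.

Lemma hom_scale_subproof (b : R) (f : hom) : linear (fun x => b *: hom_fun f x).
Proof.
by move=> a x y; rewrite /hom_fun linearP scalerDr !scalerA [b * a]mulrC.
Qed.

Definition hom0 : hom := mk_linear hom0_subproof.
Definition hom_opp f : hom := mk_linear (hom_opp_subproof f).
Definition hom_add f g : hom := mk_linear (hom_add_subproof f g).
Definition hom_scale b f : hom := mk_linear (hom_scale_subproof b f).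

Lemma hom_addA : associative hom_add.
Proof. by move=> f g h; apply: hom_ext => x; apply: addrA. Qed.
Lemma hom_addC : commutative hom_add.
Proof. by move=> f g; apply: hom_ext => x; apply: addrC. Qed.
Lemma hom_add0 : left_id hom0 hom_add.
Proof. by move=> f; apply: hom_ext => x; apply: add0r. Qed.
Lemma hom_addN : left_inverse hom0 hom_opp hom_add.
Proof. by move=> f; apply: hom_ext => x; apply: addNr. Qed.

HB.instance Definition _ :=
  GRing.isZmodule.Build hom hom_addA hom_addC hom_add0 hom_addN.

Lemma hom_scaleA a b f : hom_scale a (hom_scale b f) = hom_scale (a * b) f.
Proof. by apply: hom_ext => x; apply: scalerA. Qed.
Lemma hom_scale1 : left_id 1 hom_scale.
Proof. by move=> f; apply: hom_ext => x; apply: scale1r. Qed.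
Lemma hom_scaleDr : right_distributive hom_scale +%R.
Proof. by move=> a f g; apply: hom_ext => x; apply: scalerDr. Qed.
Lemma hom_scaleDl f : {morph hom_scale^~ f : a b / a + b}.
Proof. by move=> a b; apply: hom_ext => x; apply: scalerDl. Qed.

HB.instance Definition _ := GRing.Zmodule_isLmodule.Build R hom
  hom_scaleA hom_scale1 hom_scaleDr hom_scaleDl.

Definition factors_through_free : {pred hom} := fun f =>
  `[< exists F : lmodType R, is_free F /\
        exists (g : {linear M -> F}) (h : {linear F -> N}),
          forall x, hom_fun f x = h (g x) >].

Lemma factors_through_freeP (f : hom) :
  reflect (exists n (g : {linear M -> 'rV[R]_n}) (h : {linear 'rV[R]_n -> N}),
             forall x, hom_fun f x = h (g x))
          (f \in factors_through_free).
Proof.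
rewrite unfold_in; apply: (iffP (asboolP _)) => [[F [[n [k [k' kK k'K]]] [g [h fE]]]] | [n [g [h fE]]]].
  have k'_lin : linear k'.
    by move=> a u v; apply: (can_inj kK); rewrite linearP !k'K.
  by exists n, (mk_linear k'_lin \o g), (h \o k) => x; rewrite fE /= k'K.
exists 'rV[R]_n; split; last by exists g, h.
by exists n, idfun; exists id.
Qed.

Lemma factors_through_free_closed : submod_closed factors_through_free.
Proof.
split=> [|a f1 f2 /factors_through_freeP [n1 [g1 [h1 f1E]]]].
  by apply/factors_through_freeP; exists 0%N, \0, \0.
move=> /factors_through_freeP [n2 [g2 [h2 f2E]]]; apply/factors_through_freeP.
pose g x := row_mx (g1 x) (g2 x).
pose h v := a *: h1 (lsubmx v) + h2 (rsubmx v).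
have g_lin : linear g.
  by move=> b x y; rewrite /g !linearP scale_row_mx add_row_mx.
have h_lin : linear h.
  move=> b u v; rewrite /h.
  rewrite (linearP lsubmx) (linearP rsubmx) (linearP h1) (linearP h2).
  rewrite !scalerDr !scalerA [a * b]mulrC -!scalerA.
  by rewrite addrACA.
exists (n1 + n2)%N, (mk_linear g_lin), (mk_linear h_lin).
by move=> x; rewrite /= /h /g row_mxKl row_mxKr -f1E -f2E.
Qed.

HB.instance Definition _ := GRing.isSubmodClosed.Build R hom
  factors_through_free (GRing.submod_closed_semi factors_through_free_closed).

(* The stable Hom module: Hom_R(M, N) modulo the maps factoring through a free
   module. *)
Definition stable_hom := {ideal_quot factors_through_free}.

HB.instance Definition _ := GRing.Zmodule.on stable_hom.

Definition stable_class (f : hom) : stable_hom :=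
  \pi_({ideal_quot factors_through_free}) f.

Lemma stable_class_surj (z : stable_hom) : exists f, z = stable_class f.
Proof. by exists (repr z); rewrite /stable_class reprK. Qed.

Lemma stable_classP f g :
  stable_class f = stable_class g <-> f - g \in factors_through_free.
Proof. by rewrite Quotient.idealrBE; split=> /eqP. Qed.

Lemma stable_classD f g :
  stable_class f + stable_class g = stable_class (f + g).
Proof. by rewrite [RHS]Quotient.pi_add. Qed.

Definition stable_scale (a : R) (z : stable_hom) : stable_hom :=
  stable_class (a *: (repr z : hom)).

Lemma stable_scaleE a f : stable_scale a (stable_class f) = stable_class (a *: f).
Proof.
by apply/stable_classP; rewrite -scalerBr rpredZ //; apply/stable_classP/reprK.
Qed.

Lemma stable_scaleA a b z :
  stable_scale a (stable_scale b z) = stable_scale (a * b) z.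
Proof. by have [f ->] := stable_class_surj z; rewrite !stable_scaleE scalerA. Qed.
Lemma stable_scale1 : left_id 1 stable_scale.
Proof.
by move=> z; have [f ->] := stable_class_surj z; rewrite stable_scaleE scale1r.
Qed.
Lemma stable_scaleDr : right_distributive stable_scale +%R.
Proof.
move=> a z w; have [f ->] := stable_class_surj z.
have [g ->] := stable_class_surj w.
by rewrite stable_classD !stable_scaleE scalerDr stable_classD.
Qed.
Lemma stable_scaleDl z : {morph stable_scale^~ z : a b / a + b}.
Proof.
move=> a b; have [f ->] := stable_class_surj z.
by rewrite !stable_scaleE scalerDl stable_classD.
Qed.

HB.instance Definition _ := GRing.Zmodule_isLmodule.Build R stable_hom
  stable_scaleA stable_scale1 stable_scaleDr stable_scaleDl.


Lemma stable_hom_scaleE (a : R) (f : hom) :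
  a *: stable_class f = stable_class (a *: f).
Proof. exact: stable_scaleE. Qed.

End Hom.
Arguments factors_through_free {R} M N.

Section Stable.
Variable R : comNzRingType.
Implicit Types M N : lmodType R.

(* Isomorphism in the stable category. *)
Definition stable_iso M N : Prop :=
  exists (f : hom M N) (g : hom N M),
    ((g \o f : hom M M) - (idfun : hom M M) \in factors_through_free M M) /\
    ((f \o g : hom N N) - (idfun : hom N N) \in factors_through_free N N).

(* 0 -> N -> F -> M -> 0 is exact for some free F of finite rank. *)
Definition first_syzygy M N : Prop :=
  exists (F : lmodType R) (f : {linear N -> F}) (g : {linear F -> M}),
    is_free F /\ short_exact f g.

(* [N] is isomorphic to Omega^n M in the stable category. *)
Fixpoint syzygy (n : nat) M N : Prop :=
  if n is n'.+1 then exists L : lmodType R, first_syzygy M L /\ syzygy n' L N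
  else stable_iso M N.

(* [N] is isomorphic to M[j] in the stable category, where [1] = Omega^{-1}:
   N = Omega^(-j) M if j < 0, and Omega^j N = M if 0 <= j. *)
Definition is_shift (m : idealr R) M (j : int) N : Prop :=
  MCM m N /\
  match j with
  | Posz n => syzygy n N M
  | Negz n => syzygy n.+1 M N
  end.

End Stable.

(* The localizations M_p and R_p, as classes of fractions x / s with s not in p;
   x / s = y / t iff u (t x - s y) = 0 for some u not in p. *)
Section Localization.
Variables (R : comNzRingType) (p : prime_idealr R).

Definition denom := {s : R | s \notin p}.

Lemma denom1_subproof : 1 \notin p. Proof. by rewrite idealr1. Qed.
Definition denom1 : denom := exist (fun s => s \notin p) _ denom1_subproof.

Lemma denomM_subproof (s t : denom) : sval s * sval t \notin p.
Proof. by rewrite prime_idealrM negb_or (valP s) (valP t). Qed.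
Definition denomM (s t : denom) : denom := exist (fun s => s \notin p) _ (denomM_subproof s t).

Section LocModule.
Variable M : lmodType R.

Definition loc_rel (x y : M * denom) : bool :=
  `[< exists u : denom, sval u *: (sval y.2 *: x.1 - sval x.2 *: y.1) = 0 >].

Lemma loc_relP (x y : M * denom) : reflect
  (exists u : denom, (sval u * sval y.2) *: x.1 = (sval u * sval x.2) *: y.1)
  (loc_rel x y).
Proof.
apply: (iffP (asboolP _)) => -[u e]; exists u.
  by apply/eqP; rewrite -subr_eq0 -!scalerA -scalerBr e.
by rewrite scalerBr !scalerA e subrr.
Qed.

Lemma loc_rel_equiv : equiv_class_of loc_rel.
Proof.
split=> [x | x y | y x z].
- by apply/loc_relP; exists denom1.
- by apply/loc_relP/loc_relP => -[u e]; exists u.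
move=> /loc_relP [u e] /loc_relP [v f]; apply/loc_relP.
exists (denomM (denomM u v) y.2); rewrite /=.
have -> : sval u * sval v * sval y.2 * sval z.2
          = (sval v * sval z.2) * (sval u * sval y.2) by ring.
rewrite -scalerA e.
have -> : sval u * sval v * sval y.2 * sval x.2
          = (sval u * sval x.2) * (sval v * sval y.2) by ring.
by rewrite -[in RHS]scalerA -f !scalerA; congr (_ *: _); ring.
Qed.

Canonical loc_equiv := EquivRelPack loc_rel_equiv.
Canonical loc_encModRel := defaultEncModRel loc_rel.

Definition loc := {eq_quot loc_rel}.
HB.instance Definition _ := Choice.on loc.
HB.instance Definition _ := EqQuotient.on loc.

Definition frac (x : M) (s : denom) : loc := \pi_loc (x, s).

Lemma frac_surj (z : loc) : exists x s, z = frac x s.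
Proof. by case e: (repr z) => [x s]; exists x, s; rewrite /frac -e reprK. Qed.

Lemma fracP x s y t :
  frac x s = frac y t <->
  exists u : denom, (sval u * sval t) *: x = (sval u * sval s) *: y.
Proof. by split=> [/eqmodP /loc_relP | e]; last exact/eqmodP/loc_relP. Qed.

Definition loc_add (z w : loc) : loc :=
  let: (x, s) := repr z in let: (y, t) := repr w in
  frac (sval t *: x + sval s *: y) (denomM s t).
Definition loc_opp (z : loc) : loc :=
  let: (x, s) := repr z in frac (- x) s.
Definition loc0 : loc := frac 0 denom1.

Lemma repr_frac x s : exists y t (u : denom),
  repr (frac x s) = (y, t) /\ (sval u * sval t) *: x = (sval u * sval s) *: y.
Proof.
case e: (repr _) => [y t]; exists y, t.
have /fracP [u ue] : frac x s = frac y t by rewrite /frac -e reprK.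
by exists u.
Qed.

Lemma loc_addE x s y t :
  loc_add (frac x s) (frac y t) = frac (sval t *: x + sval s *: y) (denomM s t).
Proof.
have [x' [s' [u [e ue]]]] := repr_frac x s.
have [y' [t' [v [f vf]]]] := repr_frac y t.
rewrite /loc_add e f; apply/fracP; exists (denomM u v) => /=.
rewrite !scalerDr !scalerA; congr (_ + _).
  transitivity ((sval v * sval t * sval t') *: ((sval u * sval s) *: x')).
    by rewrite scalerA; congr (_ *: _); ring.
  by rewrite -ue scalerA; congr (_ *: _); ring.
transitivity ((sval u * sval s * sval s') *: ((sval v * sval t) *: y')).
  by rewrite scalerA; congr (_ *: _); ring.
by rewrite -vf scalerA; congr (_ *: _); ring.
Qed.

Lemma loc_oppE x s : loc_opp (frac x s) = frac (- x) s.
Proof.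
have [x' [s' [u [e ue]]]] := repr_frac x s.
by rewrite /loc_opp e; apply/fracP; exists u; rewrite !scalerN ue.
Qed.

Lemma loc_addA : associative loc_add.
Proof.
move=> z w v; have [x [s ->]] := frac_surj z; have [y [t ->]] := frac_surj w.
have [a [r ->]] := frac_surj v; rewrite !loc_addE; apply/fracP.
exists denom1; rewrite /= !scalerDr !scalerA addrA.
by congr (_ *: _ + _ *: _ + _ *: _); ring.
Qed.
Lemma loc_addC : commutative loc_add.
Proof.
move=> z w; have [x [s ->]] := frac_surj z; have [y [t ->]] := frac_surj w.
rewrite !loc_addE; apply/fracP; exists denom1.
by rewrite /= addrC !scalerDr !scalerA; congr (_ *: _ + _ *: _); ring.
Qed.
Lemma loc_add0 : left_id loc0 loc_add.
Proof.
move=> z; have [x [s ->]] := frac_surj z; rewrite loc_addE; apply/fracP.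
by exists denom1; rewrite /= scaler0 add0r !scalerA; congr (_ *: _); ring.
Qed.
Lemma loc_addN : left_inverse loc0 loc_opp loc_add.
Proof.
move=> z; have [x [s ->]] := frac_surj z; rewrite loc_oppE loc_addE.
by apply/fracP; exists denom1; rewrite scalerN addNr !scaler0.
Qed.

HB.instance Definition _ :=
  GRing.isZmodule.Build loc loc_addA loc_addC loc_add0 loc_addN.

End LocModule.

Definition loc_ring := loc (R^o : lmodType R).
HB.instance Definition _ := GRing.Zmodule.on loc_ring.

Section LocScale.
Variable M : lmodType R.

Definition loc_scale (a : loc_ring) (z : loc M) : loc M :=
  let: (b, s) := repr a in let: (x, t) := repr z in
  frac ((b : R) *: x) (denomM s t).

Lemma loc_scaleE (b : R) s (x : M) t :
  loc_scale (frac (b : R^o) s) (frac x t) = frac (b *: x) (denomM s t).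
Proof.
have [b' [s' [u [e ue]]]] := repr_frac (b : R^o) s.
have [x' [t' [v [f vf]]]] := repr_frac x t.
rewrite /loc_scale e f; apply/fracP; exists (denomM u v) => /=.
rewrite !scalerA.
transitivity (((sval u * sval s) * b') *: ((sval v * sval t) *: x')).
  by rewrite scalerA; congr (_ *: _); ring.
have -> : sval u * sval s * b' = sval u * sval s' * b by [].
by rewrite -vf scalerA; congr (_ *: _); ring.
Qed.
End LocScale.

Definition loc_one : loc_ring := frac (1 : R^o) denom1.
Definition loc_mul : loc_ring -> loc_ring -> loc_ring :=
  @loc_scale (R^o : lmodType R).

Lemma loc_scaleA (M : lmodType R) a b (z : loc M) :
  loc_scale a (loc_scale b z) = loc_scale (loc_mul a b) z.
Proof.
have [x [s ->]] := frac_surj z; have [c [t ->]] := frac_surj a.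
have [e [r ->]] := frac_surj b; rewrite /loc_mul !loc_scaleE; apply/fracP.
exists denom1; rewrite /= !scalerA; congr (_ *: _).
by rewrite /GRing.scale /=; ring.
Qed.
Lemma loc_scale1 (M : lmodType R) : left_id loc_one (@loc_scale M).
Proof.
move=> z; have [x [s ->]] := frac_surj z; rewrite loc_scaleE; apply/fracP.
by exists denom1; rewrite /= !scalerA; congr (_ *: _); ring.
Qed.
Lemma loc_scaleDr (M : lmodType R) : right_distributive (@loc_scale M) +%R.
Proof.
move=> a z w; have [x [s ->]] := frac_surj z; have [y [t ->]] := frac_surj w.
have [b [r ->]] := frac_surj a.
rewrite /GRing.add /= !loc_addE !loc_scaleE loc_addE; apply/fracP.
exists denom1; rewrite /= !scalerDr !scalerA.
by congr (_ *: _ + _ *: _); ring.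
Qed.
Lemma loc_scaleDl (M : lmodType R) (z : loc M) :
  {morph (@loc_scale M)^~ z : a b / a + b}.
Proof.
move=> a b; have [x [s ->]] := frac_surj z; have [c [t ->]] := frac_surj a.
have [e [r ->]] := frac_surj b.
rewrite /GRing.add /= !loc_addE !loc_scaleE loc_addE; apply/fracP.
exists denom1; rewrite /= !scalerDr !scalerA -scalerDl; congr (_ *: _).
by rewrite /GRing.scale /=; ring.
Qed.

Lemma loc_mulA : associative loc_mul.
Proof. by move=> a b c; apply: loc_scaleA. Qed.
Lemma loc_mulC : commutative loc_mul.
Proof.
move=> a b; have [c [t ->]] := frac_surj a; have [e [r ->]] := frac_surj b.
rewrite /loc_mul !loc_scaleE; apply/fracP; exists denom1.
by rewrite /= /GRing.scale /=; ring.
Qed.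
Lemma loc_mulDl : left_distributive loc_mul +%R.
Proof. by move=> a b c; apply: loc_scaleDl. Qed.
Lemma loc_one_neq0 : loc_one != 0.
Proof.
apply/eqP => /fracP [u]; rewrite /= !mulr1 scaler0 /GRing.scale /= mulr1 => u0.
by have /= := svalP u; rewrite u0 idealr0.
Qed.

HB.instance Definition _ := GRing.Zmodule_isComNzRing.Build loc_ring
  loc_mulA loc_mulC (@loc_scale1 _) loc_mulDl loc_one_neq0.

Section LocLmodule.
Variable M : lmodType R.
HB.instance Definition _ := GRing.Zmodule_isLmodule.Build loc_ring (loc M)
  (@loc_scaleA M) (@loc_scale1 M) (@loc_scaleDr M) (@loc_scaleDl M).

Lemma frac_scaleE (b : R) s (x : M) t :
  (frac (b : R^o) s : loc_ring) *: frac x t = frac (b *: x) (denomM s t).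
Proof. exact: loc_scaleE. Qed.
End LocLmodule.

Lemma frac_mulE (a b : R) s t :
  (frac (a : R^o) s : loc_ring) * frac (b : R^o) t
  = frac (a * b : R^o) (denomM s t).
Proof. exact: loc_scaleE. Qed.

End Localization.

(* The non-free locus, a subset of Spec(R). *)
Definition NF (R : comNzRingType) (M : lmodType R) (p : prime_idealr R) : Prop :=
  ~ is_free (loc p M : lmodType (loc_ring p)).

(* The primes p with dim R/p <= n. *)
Definition W (R : comNzRingType) (n : nat) (p : prime_idealr R) : Prop :=
  enat_le (krull_dim {ideal_quot p}) (Some n).

(* Main.v *)
(* Write T^j for the stable module Hom(M, M[j]), and let J be the annihilator of T^0, so that J
   kills every T^j and V(J) lies in W_1. The ring is Gorenstein of dimension d, hence for a
   finitely generated C: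
     Ext^i(C, R) = 0 for i > d - e if C has a regular sequence of length e;
     Ext^i(C, R) = 0 for i < d - r if C is supported in dimension <= r;
     C = 0 if all Ext^i(C, R) vanish, as C is then reflexive with zero dual.
   These give T^(d-2) = 0 at once. The stable Hom is the homology of the complex obtained by
   applying Hom(X, -) to a free resolution of Y, whose terms are sums of copies of the dual of X;
   dualizing it back gives: if X is maximal Cohen-Macaulay, stable Hom(Omega^(n-1) Y, X) = 0 and
   Ext^j(stable Hom(X, -), R) = 0 for j < n, then Ext^n(stable Hom(X, Y), R) = 0. For n = d - 1
   and X = Y = M[d-2] this yields Ext^i(T^0, R) = 0 for all i < d, so each y in m acts
   nilpotently on T^0 (compare T^0 with its quotient by the y-power torsion). Hence T^(d-1) has
   finite length and positive depth, so it is 0, and the case n = d, X = Y = M[d-1] gives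
   T^0 = 0, which makes M projective, hence free. *)
From HB Require Import structures.
From mathcomp Require Import all_boot all_algebra.
From mathcomp Require Import boolp.
From mathcomp Require Import ring zify.
Require Import Defs.

Set Implicit Arguments.
Unset Strict Implicit.
Unset Printing Implicit Defensive.

Import GRing.Theory.
Local Open Scope ring_scope.

(** * Linear maps and short exact sequences *)

(** Only vanishing statements about Ext(-, R) are used. Below degree d-1 they hold for modules
    killed by J, above degree d for all finitely generated modules, so exactly the degrees d-1 and d
    stay open. Depth at least 2 closes both for T^(d-2), whereas depth at least 1 closes only degree
    d for T^(d-1). This is why degree d-1 must first be closed for every module killed by J, through
    nilpotency. The duality turns the vanishing of T^(n-1) into that of Ext^n for a stable
    endomorphism module. The choice X = Y = M[n-1] is forced by Omega^(n-1) X = M, which makes the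
    stable Hom from Omega^(n-1) Y to X equal to T^(n-1); and J can be read off from X as well, since
    annihilators of stable endomorphisms agree along syzygies. The duality rests on the trace. For
    totally reflexive X and free F, a functional on Hom(X, F) is g |-> tr(g phi) for some phi: F ->
    X, so extending functionals becomes extending maps into X, and a map that factors through a free
    module can be extended whenever Ext^1 vanishes. *)

Section LinearMaps.
Variable R : comNzRingType.
Implicit Types A B C D M N : lmodType R.

Definition surj A B (f : A -> B) := forall b, exists a, f a = b.

Definition submod M (S : M -> Prop) : Prop :=
  S 0 /\ forall a x y, S x -> S y -> S (a *: x + y).

Lemma submodD M (S : M -> Prop) x y : submod S -> S x -> S y -> S (x + y).
Proof. by move=> [_ cl] Sx Sy; have := cl 1 x y Sx Sy; rewrite scale1r. Qed.

Lemma submodZ M (S : M -> Prop) a x : submod S -> S x -> S (a *: x).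
Proof. by move=> [S0 cl] Sx; have := cl a x 0 Sx S0; rewrite addr0. Qed.

Lemma submodB M (S : M -> Prop) x y : submod S -> S x -> S y -> S (x - y).
Proof.
by move=> cl Sx Sy; rewrite -scaleN1r; apply: submodD => //; apply: submodZ.
Qed.

Lemma submod_sum M (S : M -> Prop) (I : finType) (F : I -> M) :
  submod S -> (forall i, S (F i)) -> S (\sum_i F i).
Proof.
move=> cl SF; elim/big_ind: _ => [|x y|i _]; [by case: cl | exact: submodD | exact: SF].
Qed.

Lemma submod_ker A B (f : {linear A -> B}) : submod (fun x => f x = 0).
Proof. by split=> [|a x y fx fy]; rewrite ?linear0 // linearP fx fy scaler0 addr0. Qed.

Lemma submod_image A B (f : {linear A -> B}) : submod (fun y => exists x, f x = y).
Proof.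
split=> [|a _ _ [x <-] [y <-]]; first by exists 0; rewrite linear0.
by exists (a *: x + y); rewrite linearP.
Qed.

Section Quotient.
Variables (M : lmodType R) (S : M -> Prop) (S_sub : submod S).

Definition submod_pred : {pred M} := fun x => `[< S x >].

Lemma submod_pred_closed : submod_closed submod_pred.
Proof.
split=> [|a x y /asboolP Sx /asboolP Sy]; apply/asboolP; case: S_sub => // S0 cl.
exact: cl.
Qed.

HB.instance Definition _ := GRing.isSubmodClosed.Build R M
  submod_pred (GRing.submod_closed_semi submod_pred_closed).

Definition quot_mod := {ideal_quot submod_pred}.
HB.instance Definition _ := GRing.Zmodule.on quot_mod.

Definition quot_class (x : M) : quot_mod := \pi_({ideal_quot submod_pred})%qT x.

Lemma quot_class_surj (z : quot_mod) : exists x, z = quot_class x.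
Proof. by exists (repr z); rewrite /quot_class reprK. Qed.

Lemma quot_classP x y : quot_class x = quot_class y <-> S (x - y).
Proof.
rewrite /quot_class; split => [/eqP|Sxy]; first by rewrite -Quotient.idealrBE => /asboolP.
by apply/eqP; rewrite -Quotient.idealrBE; apply/asboolP.
Qed.

Lemma quot_classD x y : quot_class x + quot_class y = quot_class (x + y).
Proof. by rewrite [RHS]Quotient.pi_add. Qed.

Definition quot_scale (a : R) (z : quot_mod) := quot_class (a *: (repr z : M)).

Lemma quot_scaleE a x : quot_scale a (quot_class x) = quot_class (a *: x).
Proof.
by apply/quot_classP; rewrite -scalerBr; apply: submodZ => //; apply/quot_classP/reprK.
Qed.

Lemma quot_scaleA a b z : quot_scale a (quot_scale b z) = quot_scale (a * b) z.
Proof. by have [x ->] := quot_class_surj z; rewrite !quot_scaleE scalerA. Qed.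
Lemma quot_scale1 : left_id 1 quot_scale.
Proof. by move=> z; have [x ->] := quot_class_surj z; rewrite !quot_scaleE scale1r. Qed.
Lemma quot_scaleDr : right_distributive quot_scale +%R.
Proof.
move=> a z w; have [x ->] := quot_class_surj z; have [y ->] := quot_class_surj w.
by rewrite quot_classD !quot_scaleE scalerDr quot_classD.
Qed.
Lemma quot_scaleDl z : {morph quot_scale^~ z : a b / a + b}.
Proof.
move=> a b; have [x ->] := quot_class_surj z.
by rewrite !quot_scaleE scalerDl quot_classD.
Qed.

HB.instance Definition _ := GRing.Zmodule_isLmodule.Build R quot_mod
  quot_scaleA quot_scale1 quot_scaleDr quot_scaleDl.

Lemma quot_class_linear : linear quot_class.
Proof. by move=> a x y; rewrite -quot_classD -quot_scaleE. Qed.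

Lemma quotient_exists : exists (Q : lmodType R) (p : {linear M -> Q}),
  surj p /\ forall x, p x = 0 <-> S x.
Proof.
exists quot_mod, (mk_linear quot_class_linear); split=> [z|x].
  by have [x ->] := quot_class_surj z; exists x.
have e0 : mk_linear quot_class_linear 0 = 0 by rewrite linear0.
by rewrite -e0 /= quot_classP subr0.
Qed.

Record sub_mod := SubMod { sub_val : M; _ : sub_val \in submod_pred }.
HB.instance Definition _ := [isSub for sub_val].
HB.instance Definition _ := [Choice of sub_mod by <:].
HB.instance Definition _ := [SubChoice_isSubLmodule of sub_mod by <:].

Lemma submodule_exists : exists (U : lmodType R) (i : {linear U -> M}),
  injective i /\ forall x, S x <-> exists u, i u = x.
Proof.
have lin : linear (fun u : sub_mod => \val u) by move=> a u v; rewrite linearP.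
exists sub_mod, (mk_linear lin); split=> [|x]; first exact: val_inj.
split=> [Sx|[u <-]]; last exact/asboolP/(valP u).
have Px : x \in submod_pred by apply/asboolP.
by exists (SubMod Px).
Qed.

End Quotient.

Lemma lift_surj A B C (p : {linear A -> B}) (f : {linear A -> C}) : surj p ->
  (forall a, p a = 0 -> f a = 0) -> exists g : {linear B -> C}, forall a, g (p a) = f a.
Proof.
move=> p_surj pf; have [s sK] := choice p_surj.
have fs a : f (s (p a)) = f a.
  by apply/eqP; rewrite -subr_eq0 -linearB pf // linearB sK subrr.
have g_lin : linear (f \o s).
  by move=> a x y /=; rewrite -linearP -[in RHS]fs linearP !sK.
by exists (mk_linear g_lin) => a; apply: fs.
Qed.

Lemma lift_inj A B C (i : {linear A -> B}) (f : {linear C -> B}) : injective i ->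
  (forall c, exists a, i a = f c) -> exists g : {linear C -> A}, forall c, i (g c) = f c.
Proof.
move=> i_inj /choice [g gK].
have g_lin : linear g by move=> a x y; apply: i_inj; rewrite linearP !gK linearP.
by exists (mk_linear g_lin).
Qed.

Lemma inj_ker A B (f : {linear A -> B}) : (forall x, f x = 0 -> x = 0) -> injective f.
Proof.
by move=> ker0 x y e; apply/eqP; rewrite -subr_eq0; apply/eqP/ker0; rewrite linearB e subrr.
Qed.

Lemma rv_map_linear M n (y : 'I_n -> M) : linear (fun v : 'rV[R]_n => \sum_i v 0 i *: y i).
Proof.
move=> a u v; rewrite scaler_sumr -big_split; apply: eq_bigr => i _.
by rewrite !mxE scalerDl scalerA.
Qed.
Definition rv_map M n (y : 'I_n -> M) : {linear 'rV[R]_n -> M} := mk_linear (rv_map_linear y).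

Lemma rv_mapE M n (y : 'I_n -> M) v : rv_map y v = \sum_i v 0 i *: y i.
Proof. by []. Qed.

Lemma rv_map_delta M n (y : 'I_n -> M) i : rv_map y (delta_mx 0 i) = y i.
Proof.
rewrite rv_mapE (bigD1 i) //= mxE !eqxx scale1r big1 ?addr0 // => j ne.
by rewrite mxE eqxx (negPf ne) scale0r.
Qed.

Lemma rv_lin_eq M n (f g : {linear 'rV[R]_n -> M}) :
  (forall i, f (delta_mx 0 i) = g (delta_mx 0 i)) -> f =1 g.
Proof.
move=> e v; rewrite [v]row_sum_delta !linear_sum; apply: eq_bigr => i _.
by rewrite !linearZ e.
Qed.

Lemma rv_projective B C n (p : {linear B -> C}) (f : {linear 'rV[R]_n -> C}) :
  surj p -> exists g : {linear 'rV[R]_n -> B}, forall v, p (g v) = f v.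
Proof.
move=> p_surj; have [y yE] := choice (fun i : 'I_n => p_surj (f (delta_mx 0 i))).
exists (rv_map y); apply: (rv_lin_eq (f := p \o rv_map y)) => i.
by rewrite [LHS](congr1 p (rv_map_delta y i)).
Qed.

Lemma row_coord_linear n (j : 'I_n) : linear (fun v : 'rV[R]_n => v 0 j : R^o).
Proof. by move=> a u v; rewrite !mxE. Qed.
Definition row_coord n (j : 'I_n) : {linear 'rV[R]_n -> R^o} := mk_linear (row_coord_linear j).

Lemma row_linear M n (f : 'I_n -> {linear M -> R^o}) :
  linear (fun x => \row_j (f j x : R)).
Proof. by move=> a x y; apply/rowP => j; rewrite !mxE linearP. Qed.
Definition row_map M n (f : 'I_n -> {linear M -> R^o}) : {linear M -> 'rV[R]_n} :=
  mk_linear (row_linear f).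

Lemma scale_map_linear M (a : R) : linear (fun x : M => a *: x).
Proof. by move=> b x y; rewrite scalerDr !scalerA mulrC. Qed.
Definition scale_map M (a : R) : {linear M -> M} := mk_linear (@scale_map_linear M a).

Lemma elt_map_linear M (x : M) : linear (fun a : R^o => (a : R) *: x).
Proof. by move=> b a c; rewrite scalerDl scalerA. Qed.
Definition elt_map M (x : M) : {linear R^o -> M} := mk_linear (elt_map_linear x).

Lemma lin_ro M (f : {linear R^o -> M}) a : f a = a *: f 1.
Proof. by rewrite -linearZ; congr (f _); rewrite /GRing.scale /= mulr1. Qed.

Lemma se_inj A B C (f : {linear A -> B}) (g : {linear B -> C}) :
  short_exact f g -> injective f.
Proof. by case. Qed.
Lemma se_surj A B C (f : {linear A -> B}) (g : {linear B -> C}) :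
  short_exact f g -> surj g.
Proof. by case. Qed.
Lemma se_gf A B C (f : {linear A -> B}) (g : {linear B -> C}) x :
  short_exact f g -> g (f x) = 0.
Proof. by case=> _ ex _; apply/ex; exists x. Qed.
Lemma se_ker A B C (f : {linear A -> B}) (g : {linear B -> C}) y :
  short_exact f g -> g y = 0 -> exists x, f x = y.
Proof. by case=> _ ex _ /ex. Qed.

Lemma se_of_sub B (S : B -> Prop) : submod S ->
  exists (A C : lmodType R) (f : {linear A -> B}) (g : {linear B -> C}),
    short_exact f g /\ forall y, S y <-> exists x, f x = y.
Proof.
move=> S_sub; have [A [f [f_inj fS]]] := submodule_exists S_sub.
have [C [g [g_surj gS]]] := quotient_exists S_sub.
by exists A, C, f, g; split=> //; split=> // y; rewrite gS fS.
Qed.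

Lemma se_of_surj B C (g : {linear B -> C}) : surj g ->
  exists (A : lmodType R) (f : {linear A -> B}), short_exact f g.
Proof.
move=> g_surj; have [A [f [f_inj fS]]] := submodule_exists (submod_ker g).
by exists A, f; split.
Qed.

Lemma se_of_inj A B (f : {linear A -> B}) : injective f ->
  exists (C : lmodType R) (g : {linear B -> C}), short_exact f g.
Proof.
move=> f_inj; have [C [g [g_surj gS]]] := quotient_exists (submod_image f).
by exists C, g; split.
Qed.

Lemma image_fact A B (f : {linear A -> B}) :
  exists (I : lmodType R) (p : {linear A -> I}) (i : {linear I -> B}),
    [/\ surj p, injective i & forall a, i (p a) = f a].
Proof.
have [I [i [i_inj iS]]] := submodule_exists (submod_image f).
have [|p pE] := lift_inj (f := f) i_inj; first by move=> a; apply/iS; exists a.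
exists I, p, i; split=> // x; have /iS [a fa] : exists u, i u = i x by exists x.
by exists a; apply: i_inj; rewrite pE.
Qed.

Lemma se_ext A B C N (i : {linear A -> B}) (p : {linear B -> C}) (f : {linear B -> N}) :
  short_exact i p -> (forall a, f (i a) = 0) ->
  exists g : {linear C -> N}, forall b, g (p b) = f b.
Proof.
move=> ex fi; apply: lift_surj; first exact: se_surj ex.
by move=> b /(se_ker ex) [a <-].
Qed.

Lemma se_lift A B C N (i : {linear A -> B}) (p : {linear B -> C}) (f : {linear N -> B}) :
  short_exact i p -> (forall x, p (f x) = 0) ->
  exists g : {linear N -> A}, forall x, i (g x) = f x.
Proof.
move=> ex pf; apply: lift_inj; first exact: se_inj ex.
by move=> x; apply: (se_ker ex).
Qed.

End LinearMaps.

(** * Noetherian and local rings *)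

Section Noetherian.
Variable R : comNzRingType.
Implicit Types A B C D M N : lmodType R.
Hypothesis R_noeth : noetherian R.

(** Ideals are predicates here so that the unit ideal, which [idealr] excludes, takes part in
    Noetherian induction. *)
Definition is_ideal (a : R -> Prop) : Prop := submod (M := R^o) a.

Lemma is_idealM a x y : is_ideal a -> a y -> a (x * y).
Proof. by move=> ida ay; apply: (submodZ x ida ay). Qed.

Lemma ideal_of_set (a : R -> Prop) : is_ideal a -> ~ a 1 ->
  exists I : idealr R, forall x, x \in I <-> a x.
Proof.
move=> [a0 acl] a1; pose p : {pred R} := fun x => `[< a x >].
have pP x : x \in p <-> a x by split=> /asboolP.
have p_cl : idealr_closed p.
  split; first exact/pP; first by apply/negP => /pP.
  by move=> b x y /pP ax /pP ay; apply/pP; apply: acl.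
pose I : idealr R := HB.pack p (isIdealr.Build R p p_cl).
by exists I.
Qed.

Lemma prime_of_set (a : R -> Prop) : is_ideal a -> ~ a 1 ->
  (forall x y, a (x * y) -> a x \/ a y) ->
  exists I : prime_idealr R, forall x, x \in I <-> a x.
Proof.
move=> [a0 acl] a1 aP; pose p : {pred R} := fun x => `[< a x >].
have pP x : x \in p <-> a x by split=> /asboolP.
have p_cl : idealr_closed p.
  split; first exact/pP; first by apply/negP => /pP.
  by move=> b x y /pP ax /pP ay; apply/pP; apply: acl.
have p_pr : prime_idealr_closed p.
  by move=> x y /pP /aP [] /pP ->; rewrite ?orbT.
pose I : prime_idealr R :=
  HB.pack p (isIdealr.Build R p p_cl) (isPrimeIdealrClosed.Build R p p_pr).
by exists I.
Qed.

Lemma idealr_set (I : idealr R) : is_ideal (fun x => x \in I).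
Proof.
by split=> [|a x y xI yI]; rewrite ?idealr0 // rpredD // /GRing.scale /= idealMr.
Qed.

Lemma prime_set (I : prime_idealr R) : is_ideal (fun x => x \in I).
Proof. exact: (idealr_set I). Qed.

Lemma ideal_fin_gen (a : R -> Prop) : is_ideal a -> exists k (g : 'I_k -> R),
  (forall i, a (g i)) /\ forall x, a x -> exists c : 'I_k -> R, x = \sum_i c i * g i.
Proof.
move=> ida; have [a1|a1] := pselect (a 1).
  exists 1%N, (fun=> 1); split=> // x _; exists (fun=> x).
  by rewrite big_ord_recl big_ord0 mulr1 addr0.
have [I aI] := ideal_of_set ida a1; have [n [g gI]] := R_noeth I.
exists n, g; split=> [i|x /aI /gI //]; apply/aI/gI; exists (fun j => (j == i)%:R).
by rewrite (bigD1 i) //= eqxx mul1r big1 ?addr0 // => j /negPf ->; rewrite mul0r.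
Qed.

(** A failure of [P] yields, by choice, a strictly increasing sequence of ideals. Its union is
    finitely generated, and the sum [N] of the stages at which the generators appear is a stage
    already containing all of them. *)
Lemma noeth_ind (P : (R -> Prop) -> Prop) :
  (forall a, is_ideal a ->
     (forall b, is_ideal b -> (forall x, a x -> b x) -> (exists x, b x /\ ~ a x) -> P b) ->
     P a) ->
  forall a, is_ideal a -> P a.
Proof.
move=> step a ida; apply: contrapT => nPa.
pose T := {b : R -> Prop | is_ideal b /\ ~ P b}.
have next (b : T) : exists c : T,
    (forall x, sval b x -> sval c x) /\ exists x, sval c x /\ ~ sval b x.
  case: b => b [idb nPb] /=; apply: contrapT => nex; apply: nPb; apply: step => //.
  move=> c idc bc cb; apply: contrapT => nPc; apply: nex.
  by exists (exist _ c (conj idc nPc)).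
have [f fP] := choice next; pose s n := iter n f (exist _ a (conj ida nPa) : T).
have s_mono n k x : sval (s n) x -> sval (s (n + k)%N) x.
  elim: k => [|k IH] sx; first by rewrite addn0.
  by rewrite addnS; apply: (fP _).1; apply: IH.
have idU : is_ideal (fun x => exists n, sval (s n) x).
  split=> [|b x y [n sx] [k sy]]; first by exists 0%N; case: (svalP (s 0%N)) => -[].
  exists (n + k)%N; case: (svalP (s (n + k)%N)) => -[_ cl] _; apply: cl.
    exact: s_mono.
  by rewrite addnC; apply: s_mono.
have [k [g [gU gen]]] := ideal_fin_gen idU; have [h hP] := choice gU.
pose N := (\sum_i h i)%N.
have [x [sx nsx]] := (fP (s N)).2; apply: nsx.
have [c ->] : exists c : 'I_k -> R, x = \sum_i c i * g i by apply: gen; exists N.+1.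
have idN : is_ideal (sval (s N)) by case: (svalP (s N)).
apply: (@submod_sum R R^o (sval (s N)) _ (fun i => c i * g i) idN) => i.
apply: is_idealM => //.
by rewrite /N (bigD1 i) //=; apply: s_mono.
Qed.

Lemma fin_genP M : fin_gen M <-> exists n (p : {linear 'rV[R]_n -> M}), surj p.
Proof.
split=> [[n [g gen]]|[n [p p_surj]]].
  exists n, (rv_map g) => x; have [c ->] := gen x; exists (\row_i c i).
  by rewrite rv_mapE; apply: eq_bigr => i _; rewrite mxE.
exists n, (fun i => p (delta_mx 0 i)) => x; have [v <-] := p_surj x.
exists (fun i => v 0 i); rewrite {1}[v]row_sum_delta linear_sum.
by apply: eq_bigr => i _; rewrite linearZ.
Qed.

Lemma fin_gen_rv n : fin_gen ('rV[R]_n : lmodType R).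
Proof. by apply/fin_genP; exists n, idfun => v; exists v. Qed.

Lemma fin_gen_ro : fin_gen (R^o : lmodType R).
Proof.
exists 1%N, (fun=> 1) => x; exists (fun=> x).
by rewrite big_ord_recl big_ord0 addr0 /GRing.scale /= mulr1.
Qed.

Lemma fin_gen_surj M N (f : {linear M -> N}) : surj f -> fin_gen M -> fin_gen N.
Proof.
move=> f_surj /fin_genP [n [p p_surj]]; apply/fin_genP; exists n, (f \o p) => y.
by have [x <-] := f_surj y; have [v <-] := p_surj x; exists v.
Qed.

Definition sub_gen n (S : 'rV[R]_n -> Prop) := exists k (g : 'I_k -> 'rV[R]_n),
  (forall i, S (g i)) /\ forall x, S x -> exists c : 'I_k -> R, x = \sum_i c i *: g i.

(** Generators are lifts of generators of the ideal of first coordinates, together with generators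
    of the part of [S] whose first coordinate is 0. *)
Lemma rv_sub_gen_step n (S : 'rV[R]_(1 + n) -> Prop) :
  (forall S' : 'rV[R]_n -> Prop, submod S' -> sub_gen S') -> submod S -> sub_gen S.
Proof.
move=> IH S_sub.
pose a r := exists v : 'rV[R]_n, S (row_mx (r%:M : 'rV_1) v).
have ida : is_ideal a.
  split=> [|b x y [u Su] [v Sv]].
    by exists 0; rewrite raddf0 row_mx0; case: S_sub.
  exists (b *: u + v); have := S_sub.2 b _ _ Su Sv.
  rewrite scale_row_mx add_row_mx scale_scalar_mx -raddfD.
  by [].
have S'_sub : submod (fun v : 'rV[R]_n => S (row_mx (0 : 'rV_1) v)).
  split=> [|b u v Su Sv]; first by rewrite row_mx0; case: S_sub.
  by have := S_sub.2 b _ _ Su Sv; rewrite scale_row_mx add_row_mx scaler0 addr0.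
have [k1 [g1 [ag1 gen1]]] := ideal_fin_gen ida; have [v1 v1P] := choice ag1.
have [k2 [g2 [Sg2 gen2]]] := IH _ S'_sub.
pose w i := row_mx ((g1 i)%:M : 'rV_1) (v1 i).
pose g (i : 'I_(k1 + k2)) : 'rV[R]_(1 + n) :=
  match split i with inl i1 => w i1 | inr i2 => row_mx 0 (g2 i2) end.
exists (k1 + k2)%N, g; split=> [i|x Sx]; first by rewrite /g; case: split => j; [apply: v1P | apply: Sg2].
have [c1 xE] : exists c : 'I_k1 -> R, x 0 0 = \sum_i c i * g1 i.
  apply: gen1; exists (rsubmx x).
  have -> : (x 0 0)%:M = lsubmx x.
    by apply/rowP => j; rewrite !mxE ord1 eqxx mulr1n; congr (x _ _); apply/eqP; rewrite -val_eqE /=.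
  by rewrite hsubmxK.
pose y := x - \sum_i c1 i *: w i.
have Sy : S y.
  apply: submodB => //; apply: submod_sum => // i; apply: submodZ => //; exact: v1P.
have y0 : lsubmx y = 0.
  apply/rowP => j; rewrite !mxE ord1 summxE.
  have -> : lshift n (0 : 'I_1) = 0 by apply: val_inj.
  rewrite xE -sumrB big1 // => i _; rewrite [X in _ - X]mxE.
  have -> : (0 : 'I_(1 + n)) = lshift n (0 : 'I_1) by apply: val_inj.
  rewrite /w row_mxEl. by rewrite mxE eqxx mulr1n subrr.
have [c2 yE] : exists c : 'I_k2 -> R, rsubmx y = \sum_i c i *: g2 i.
  by apply: gen2; rewrite -y0 hsubmxK.
have gE i : g (rshift k1 i) = row_mx 0 (g2 i).
  by rewrite -[rshift _ _]/(unsplit (inr i)) /g unsplitK.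
have gl i : lsubmx (g (rshift k1 i)) = 0 by rewrite gE row_mxKl.
have gr i : rsubmx (g (rshift k1 i)) = g2 i by rewrite gE row_mxKr.
exists (fun i => match split i with inl i1 => c1 i1 | inr i2 => c2 i2 end).
rewrite big_split_ord /=.
transitivity (\sum_i c1 i *: w i + y); first by rewrite addrC subrK.
congr (_ + _).
  by apply: eq_bigr => i _; rewrite /g -[lshift _ _]/(unsplit (inl i)) unsplitK.
rewrite -[LHS]hsubmxK y0 yE -[RHS]hsubmxK; congr row_mx.
  by rewrite linear_sum big1 // => i _; rewrite linearZ /= gl scaler0.
by rewrite linear_sum; apply: eq_bigr => i _; rewrite linearZ /= gr -[rshift _ _]/(unsplit (inr i)) unsplitK.
Qed.

Lemma rv_sub_gen n (S : 'rV[R]_n -> Prop) : submod S -> sub_gen S.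
Proof.
elim: n S => [|n IH] S S_sub; last exact: (rv_sub_gen_step (n := n) IH S_sub).
exists 0%N, (fun=> 0); split=> [[] //|x _]; exists (fun=> 0).
by rewrite big_ord0; apply/rowP => -[].
Qed.

Lemma fin_gen_sub A M (f : {linear A -> M}) : injective f -> fin_gen M -> fin_gen A.
Proof.
move=> f_inj /fin_genP [n [p p_surj]].
have S_sub : submod (fun v => exists a, f a = p v).
  split=> [|b u v [x xE] [y yE]]; first by exists 0; rewrite !linear0.
  by exists (b *: x + y); rewrite !linearP xE yE.
have [k [g [Sg gen]]] := rv_sub_gen S_sub; have [h hE] := choice Sg.
exists k, h => x; have [v vE] := p_surj (f x).
have [c cE] := gen v (ex_intro _ x (esym vE)); exists c; apply: f_inj.
rewrite -vE cE !linear_sum; apply: eq_bigr => i _.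
by rewrite !linearZ hE.
Qed.

Lemma fg_presentation C : fin_gen C -> exists n (K : lmodType R)
  (i : {linear K -> 'rV[R]_n}) (p : {linear 'rV[R]_n -> C}), short_exact i p /\ fin_gen K.
Proof.
move=> /fin_genP [n [p p_surj]]; have [K [i ex]] := se_of_surj p_surj.
exists n, K, i, p; split=> //; exact: fin_gen_sub (se_inj ex) (fin_gen_rv n).
Qed.

Definition kills (a : R -> Prop) M := forall x (c : M), a x -> x *: c = 0.

(** Noetherian induction on an ideal killing C, in place of a prime filtration. Induction on the
    number of generators reduces to a cyclic C = R/b. If b is not prime, say u v is in b, then C is
    an extension of C/uC, killed by u, by uC, killed by v, and both have larger annihilators. If b
    is a prime q, the induction hypothesis is handed to the prime case for modules killed by q and
    by one more element. *)
Lemma devissage (P : lmodType R -> Prop) (a : R -> Prop) : is_ideal a ->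
  (forall C, (forall x : C, x = 0) -> P C) ->
  (forall A B C (f : {linear A -> B}) (g : {linear B -> C}),
     short_exact f g -> P A -> P C -> P B) ->
  (forall q : prime_idealr R, (forall x, a x -> x \in q) ->
     forall C (p : {linear R^o -> C}), surj p -> (forall r, p r = 0 <-> r \in q) ->
     (forall D, fin_gen D -> kills (fun x => x \in q) D ->
        (exists y, y \notin q /\ forall d : D, y *: d = 0) -> P D) -> P C) ->
  forall C, fin_gen C -> kills a C -> P C.
Proof.
move=> ida P0 Pext Pprime.
suff main : forall b, is_ideal b -> (forall x, a x -> b x) ->
  forall C, fin_gen C -> kills b C -> P C by apply: main.
move=> b; pattern b; move: b; apply: noeth_ind => b idb IH ab.
have fg_sub := fin_gen_sub.
have cyc C (p : {linear R^o -> C}) : surj p -> kills b C -> P C.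
  move=> p_surj kb; have fgC : fin_gen C := fin_gen_surj p_surj fin_gen_ro.
  have killE x : p x = 0 <-> forall c : C, x *: c = 0.
    split=> [px c|xC]; last by rewrite lin_ro.
    have [r <-] := p_surj c.
    by rewrite (lin_ro p r) scalerA mulrC -scalerA -(lin_ro p x) px scaler0.
  have bigger D : fin_gen D -> kills b D -> (exists x, (forall d : D, x *: d = 0) /\ ~ b x) ->
      P D.
    move=> fgD kD [x [xD nbx]]; apply: (IH (fun x => forall d : D, x *: d = 0)) => //.
    - split=> [d|r y z yD zD d]; first by rewrite scale0r.
      by rewrite scalerDl -scalerA yD zD scaler0 addr0.
    - by move=> y yb d; apply: kD.
    - by exists x.
    - by move=> y ay d; apply: kD; apply: ab.
  have [[x [xC nbx]]|ker] := pselect (exists x, (forall c : C, x *: c = 0) /\ ~ b x).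
    by apply: bigger => //; exists x.
  have pb x : p x = 0 <-> b x.
    split=> [/killE xC|bx]; last by apply/killE => c; apply: kb.
    by apply: contrapT => nbx; apply: ker; exists x.
  have [b1|b1] := pselect (b 1).
    by apply: P0 => c; rewrite -[c]scale1r; apply: kb.
  have [pr|npr] := pselect (forall x y, b (x * y) -> b x \/ b y).
    have [q qb] := prime_of_set idb b1 pr.
    apply: (Pprime q _ C p p_surj).
    - by move=> x ax; apply/qb; apply: ab.
    - by move=> r; rewrite qb.
    move=> D fgD kD [y [yq yD]]; apply: bigger => //.
      by move=> x d bx; apply: kD; apply/qb.
    by exists y; split=> // /qb; apply/negP.
  move/existsNP: npr => [u /existsNP [v /not_implyP [buv /not_orP [nbu nbv]]]].
  have [I [p1 [i [p1_surj i_inj pi]]]] := image_fact (scale_map C u).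
  have [Q [g ex]] := se_of_inj i_inj.
  apply: (Pext _ _ _ _ _ ex); apply: bigger.
  - exact: fin_gen_surj p1_surj fgC.
  - by move=> x c bx; apply: i_inj; rewrite linearZ linear0 /= kb.
  - exists v; split=> // c; apply: i_inj; rewrite linearZ linear0 /=.
    have [c' <-] := p1_surj c; rewrite pi /= scalerA kb //.
    by rewrite mulrC.
  - exact: fin_gen_surj (se_surj ex) fgC.
  - move=> x c bx; have [c' <-] := se_surj ex c; by rewrite -linearZ kb // linear0.
  - exists u; split=> // c; have [c' <-] := se_surj ex c.
    by rewrite -linearZ -[_ *: _]/(scale_map C u c') -pi (se_gf _ ex).
move=> C [n [g gen]] kC.
elim: n => [|n IHn] in C g gen kC *.
  by apply: P0 => x; have [c ->] := gen x; rewrite big_ord0.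
have [A [p [i [p_surj i_inj pi]]]] := image_fact (elt_map (g ord0)).
have [Q [q ex]] := se_of_inj i_inj.
apply: (Pext _ _ _ _ _ ex).
  apply: (cyc A p) => // x c bx; apply: i_inj; by rewrite linearZ linear0 /= kC.
apply: (IHn Q (fun j => q (g (lift ord0 j)))) => [z|x z bx].
  have [y <-] := se_surj ex z; have [c ->] := gen y.
  exists (fun j => c (lift ord0 j)); rewrite linear_sum big_ord_recl.
  have -> : q (c ord0 *: g ord0) = 0.
    by rewrite -[_ *: _]/(elt_map (g ord0) (c ord0)) -pi (se_gf _ ex).
  by rewrite add0r; apply: eq_bigr => j _; rewrite linearZ.
by have [y <-] := se_surj ex z; rewrite -linearZ kC // linear0.
Qed.

(* The quotient M/S is generated by g and equals y (M/S). *)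
Lemma nakayama M (S : M -> Prop) n (g : 'I_n -> M) (y : R) : submod S ->
  (forall v, exists (c : 'I_n -> R) s, S s /\ v = \sum_i c i *: g i + s) ->
  (forall a, exists s, s * (1 - a * y) = 1) ->
  (forall v, exists w s, S s /\ v = y *: w + s) -> forall v, S v.
Proof.
move=> S_sub gen yu yM; elim: n g gen => [|n IH] g gen.
  by move=> v; have [c [s [Ss ->]]] := gen v; rewrite big_ord0 add0r.
pose h (j : 'I_n) := g (lift ord0 j).
suff [c [s [Ss gE]]] : exists (c : 'I_n -> R) s, S s /\ g ord0 = \sum_i c i *: h i + s.
  apply: (IH h) => v; have [c' [s' [Ss' ->]]] := gen v.
  exists (fun j => c' ord0 * c j + c' (lift ord0 j)), (c' ord0 *: s + s').
  split; first by case: S_sub => _; apply.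
  rewrite big_ord_recl gE scalerDr scaler_sumr -!addrA.
  have -> : \sum_i (c' ord0 * c i + c' (lift ord0 i)) *: h i
    = \sum_i c' ord0 *: (c i *: h i) + \sum_i c' (lift ord0 i) *: h i.
    by rewrite -big_split; apply: eq_bigr => i _; rewrite scalerDl scalerA.
  by rewrite -!addrA; congr (_ + _); rewrite addrCA.
(* Expanding g_0 = y w + s makes its own coefficient a multiple of [y]; since 1 - c y is a unit, g_0
   can be solved for and dropped. *)
have [w [s [Ss gE]]] := yM (g ord0); have [c [s' [Ss' wE]]] := gen w.
have [u uE] := yu (c ord0).
exists (fun j => u * (y * c (lift ord0 j))), (u *: (y *: s' + s)); split.
  by apply: submodZ => //; case: S_sub => _; apply.
transitivity (u *: ((1 - c ord0 * y) *: g ord0)); first by rewrite scalerA uE scale1r.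
have -> : (1 - c ord0 * y) *: g ord0
    = y *: (\sum_(i < n) c (lift ord0 i) *: h i) + (y *: s' + s).
  rewrite scalerBl scale1r {1}gE wE big_ord_recl !scalerDr scalerA [y * _]mulrC.
  by rewrite -!addrA addrC -!addrA [X in _ + (_ + X)]addrC !addrA subrK.
rewrite scalerDr; congr (_ + _); rewrite !scaler_sumr.
by apply: eq_bigr => i _; rewrite !scalerA.
Qed.

Section Local.
Variable m : idealr R.
Hypothesis R_local : is_local m.

(** By Noetherian induction: a proper ideal either lies in a strictly larger proper one or is itself
    maximal, hence equal to [m]. *)
Lemma local_proper (a : R -> Prop) : is_ideal a -> ~ a 1 -> forall x, a x -> x \in m.
Proof.
move: a; apply: noeth_ind => a ida IH a1 x ax.
have [[b [idb [ab [c [b1 c_b]]]]]|nex] := pselect (exists b, is_ideal b /\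
    (forall x, a x -> b x) /\ exists c, ~ b 1 /\ (b c /\ ~ a c)).
  by apply: (IH b) => //; [exists c | apply: ab].
have [I Ia] := ideal_of_set ida a1.
have Imax : maximal_ideal I.
  move=> J IJ y yJ; apply/Ia; apply: contrapT => nay; apply: nex.
  exists (fun x => x \in J); split; first exact: idealr_set.
  split=> [z /Ia /IJ //|]; exists y; split=> //; by rewrite idealr1.
by rewrite -(R_local.2 I Imax); apply/Ia.
Qed.

Lemma local_unit x : x \notin m -> exists y, y * x = 1.
Proof.
move=> xm; apply: contrapT => nex; move/negP: xm; apply.
apply: (local_proper (a := fun z => exists y, y * x = z)); last by exists 1; rewrite mul1r.
  split=> [|b _ _ [y <-] [z <-]]; first by exists 0; rewrite mul0r.
  by exists (b * y + z); rewrite mulrDl -mulrA.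
by move=> [y yx]; apply: nex; exists y.
Qed.

Lemma local_unit1 y : y \in m -> forall a, exists s, s * (1 - a * y) = 1.
Proof.
move=> ym a; apply: local_unit; apply/negP => h.
have : 1 \in m by rewrite -[1](subrK (a * y)) rpredD // idealMr.
by rewrite idealr1.
Qed.

Lemma local_le (p : prime_idealr R) x : x \in p -> x \in m.
Proof.
move=> xp; apply: (local_proper (a := fun z => z \in p)) => //; first exact: prime_set.
by rewrite idealr1.
Qed.

Lemma local_prime : exists p : prime_idealr R, forall x, x \in p <-> x \in m.
Proof.
apply: prime_of_set => [||x y xy]; [exact: idealr_set | by rewrite idealr1 |].
have [xm|xm] := boolP (x \in m); [by left | right].
by have [z zx] := local_unit xm; rewrite -[y]mul1r -zx -mulrA idealMr.
Qed.

End Local.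
End Noetherian.

(** * Vanishing of Ext(-, N) from an injective coresolution *)

Section Coresolution.
Variable R : comNzRingType.
Implicit Types A B C D M N : lmodType R.

Definition shift_seq N (I : nat -> lmodType R) (i : nat) : lmodType R :=
  if i is j.+1 then I j else N.

Record coresolution N := Coresolution {
  cosyz : nat -> lmodType R;
  inj_term : nat -> lmodType R;
  cores_in : forall i, {linear shift_seq N cosyz i -> inj_term i};
  cores_out : forall i, {linear inj_term i -> cosyz i};
  inj_termP : forall i, injective_module (inj_term i);
  cores_exact : forall i, short_exact (cores_in i) (cores_out i);
  cores_finite : exists n, forall i, (n <= i)%N -> forall x : cosyz i, x = 0 }.

Lemma zero_injective : injective_module ('rV[R]_0 : lmodType R).
Proof. by move=> A B i f _; exists \0 => x; apply/rowP => -[]. Qed.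

Lemma coresolution_exists n N : inj_dim_le n N -> inhabited (coresolution N).
Proof.
elim: n N => [|n IH] N /=.
  move=> N_inj; pose Z : lmodType R := 'rV[R]_0.
  pose E i := shift_seq N (fun=> Z) i.
  have E_inj i : injective_module (E i) by case: i => [|i] //; apply: zero_injective.
  have ex i : short_exact (idfun : {linear E i -> E i}) (\0 : {linear E i -> Z}).
    split=> // y; last by exists 0; apply/rowP => -[].
    by split=> // _; exists y.
  have fin : exists n, forall i, (n <= i)%N -> forall x : Z, x = 0.
    by exists 0%N => i _ x; apply/rowP => -[].
  by constructor; apply: (Coresolution E_inj ex fin).
move=> [E [C [f [g [E_inj fg_ex /IH [[I E' f' g' E'_inj ex' fin']]]]]]].
pose I0 := shift_seq C I; pose E0 := shift_seq E E'.
pose f0 i : {linear shift_seq N I0 i -> E0 i} :=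
  match i return {linear shift_seq N I0 i -> E0 i} with 0 => f | j.+1 => f' j end.
pose g0 i : {linear E0 i -> I0 i} :=
  match i return {linear E0 i -> I0 i} with 0 => g | j.+1 => g' j end.
constructor; apply: (@Coresolution N I0 E0 f0 g0); [by case | by case |].
have [k kP] := fin'; exists k.+1 => -[//|i] ki x; exact: kP.
Qed.

Variables (N : lmodType R) (res : coresolution N).

Definition coz i := shift_seq N (cosyz res) i.
Definition inj_mod i := shift_seq 'rV[R]_0 (inj_term res) i.

Definition bd i : {linear inj_mod i -> coz i} :=
  match i return {linear inj_mod i -> coz i} with 0 => \0 | j.+1 => cores_out res j end.
Definition cin i : {linear coz i -> inj_mod i.+1} := cores_in res i.

Lemma cin_exact i : short_exact (cin i) (bd i.+1).
Proof. exact: cores_exact. Qed.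

Lemma inj_mod_injective i : injective_module (inj_mod i).
Proof. by case: i => [|i]; [apply: zero_injective | apply: inj_termP]. Qed.

Lemma inj_ext A B i (f : {linear A -> B}) (h : {linear A -> inj_mod i}) :
  injective f -> exists g : {linear B -> inj_mod i}, forall x, g (f x) = h x.
Proof. exact: inj_mod_injective. Qed.

(* [ext0 i C] says that Ext^i(C, N) = 0: Ext^i is the cokernel of
   Hom(C, E_(i-1)) -> Hom(C, I_i), where E_(-1) = 0 and I_0 = N. *)
Definition ext0 i C := forall f : {linear C -> coz i},
  exists g : {linear C -> inj_mod i}, forall c, bd i (g c) = f c.

Lemma ext0_zero i C : (forall x : C, x = 0) -> ext0 i C.
Proof. by move=> C0 f; exists \0 => c; rewrite (C0 c) !linear0. Qed.

Lemma ext0_hom C : ext0 0 C <-> forall (f : {linear C -> N}) c, f c = 0.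
Proof.
split=> [C0 f c|C0 f]; first by have [g <-] := C0 f.
by exists \0 => c; rewrite [RHS]C0.
Qed.

Lemma ext0_large : exists n, forall i C, (n <= i)%N -> ext0 i C.
Proof.
have [n nP] := cores_finite res; exists n.+1 => -[//|i] C ni f; exists \0 => c.
by rewrite linear0 [RHS]nP.
Qed.

Lemma ext0_mid A B C (f : {linear A -> B}) (g : {linear B -> C}) i :
  short_exact f g -> ext0 i A -> ext0 i C -> ext0 i B.
Proof.
move=> ex A0 C0 h; have [k kE] := A0 (h \o f).
have [k' k'E] := inj_ext k (se_inj ex).
have [|l lE] := se_ext (f := h \- (bd i \o k')) ex.
  by move=> a /=; rewrite k'E kE subrr.
have [l' l'E] := C0 l; exists ((l' \o g) \+ k') => b /=.
by rewrite linearD l'E lE /= subrK.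
Qed.

(** A statement on maps and not on Ext classes: at i = 0 it extends honest functionals. A map is
    first extended into the next injective; its image one step further descends to C, lifts because
    Ext^(i+1)(C) = 0, and is subtracted. *)
Lemma ext0_extend A B C (f : {linear A -> B}) (g : {linear B -> C}) i :
  short_exact f g -> ext0 i.+1 C -> forall h : {linear A -> coz i},
  exists k : {linear B -> coz i}, forall a, k (f a) = h a.
Proof.
move=> ex C0 h; have [k kE] := inj_ext (cin i \o h) (se_inj ex).
have [|l lE] := se_ext (f := bd i.+1 \o k) ex.
  by move=> a /=; rewrite kE /= (se_gf _ (cin_exact i)).
have [l' l'E] := C0 l.
have [|k' k'E] := se_lift (f := k \- (l' \o g)) (cin_exact i).
  by move=> b /=; rewrite linearB /= l'E lE subrr.
exists k' => a; apply: (se_inj (cin_exact i)).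
by rewrite k'E /= kE (se_gf _ ex) linear0 subr0.
Qed.

Lemma ext0_left A B C (f : {linear A -> B}) (g : {linear B -> C}) i :
  short_exact f g -> ext0 i B -> ext0 i.+1 C -> ext0 i A.
Proof.
move=> ex B0 C0 h; have [k kE] := ext0_extend ex C0 h.
by have [l lE] := B0 k; exists (l \o f) => a /=; rewrite lE kE.
Qed.

(** The converse of [ext0_extend], given Ext^(i+1)(B) = 0. It reduces an Ext computation to
    extending concrete maps. *)
Lemma ext0_right_of_extend A B C (f : {linear A -> B}) (g : {linear B -> C}) i :
  short_exact f g -> ext0 i.+1 B ->
  (forall h : {linear A -> coz i}, exists k : {linear B -> coz i}, forall a, k (f a) = h a) ->
  ext0 i.+1 C.
Proof.
move=> ex B0 hA h; have [k kE] := B0 (h \o g).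
have [|l lE] := se_lift (f := k \o f) (cin_exact i).
  by move=> a /=; rewrite kE /= (se_gf _ ex) linear0.
have [l' l'E] := hA l.
have [|k' k'E] := se_ext (f := k \- (cin i \o l')) ex.
  by move=> a /=; rewrite l'E lE /= subrr.
exists k' => c; have [b <-] := se_surj ex c.
by rewrite k'E /= linearB /= kE (se_gf _ (cin_exact i)) subr0.
Qed.

Lemma ext0_right A B C (f : {linear A -> B}) (g : {linear B -> C}) i :
  short_exact f g -> ext0 i A -> ext0 i.+1 B -> ext0 i.+1 C.
Proof.
move=> ex A0 B0; apply: (ext0_right_of_extend ex B0) => h.
have [k kE] := A0 h; have [k' k'E] := inj_ext k (se_inj ex).
by exists (bd i \o k') => a /=; rewrite k'E kE.
Qed.

Lemma ext0_quotient A B (f : {linear A -> B}) : surj f -> ext0 0 A -> ext0 0 B.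
Proof.
move=> f_surj /ext0_hom A0; apply/ext0_hom => h b; have [a <-] := f_surj b.
exact: (A0 (h \o f)).
Qed.

Lemma ext0_rv i n : ext0 i.+1 'rV[R]_n.
Proof. by move=> f; apply: rv_projective; apply: se_surj (cin_exact i). Qed.

Lemma ext0_iso i A B (f : {linear A -> B}) : bijective f -> ext0 i A -> ext0 i B.
Proof.
move=> [g fK gK] A0 h; have [k kE] := A0 (h \o f).
have g_lin : linear g by move=> a x y; apply: (can_inj fK); rewrite linearP !gK.
by exists (k \o mk_linear g_lin) => b /=; rewrite kE /= gK.
Qed.

Hypothesis R_noeth : noetherian R.
Hypothesis N_fg : fin_gen N.

Definition liftable i C (f : hom C (coz i)) : Prop :=
  exists g : {linear C -> inj_mod i}, forall c, bd i (g c) = hom_fun f c.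

Lemma liftable_submod i C : submod (@liftable i C).
Proof.
split=> [|a f g [f' f'E] [g' g'E]]; first by exists \0 => c; rewrite linear0.
exists ((scale_map _ a \o f') \+ g') => c /=.
by rewrite linearD linearZ /= f'E g'E.
Qed.

Lemma hom_sumE C D (I : finType) (F : I -> hom C D) c :
  hom_fun (\sum_i F i) c = \sum_i hom_fun (F i) c.
Proof. by apply: (big_morph (fun f => hom_fun f c)). Qed.

Lemma fin_gen_hom C D : fin_gen C -> fin_gen D -> fin_gen (hom C D).
Proof.
move=> [n [g gen]] fgD.
have fgDn : fin_gen ({ffun 'I_n -> D} : lmodType R).
  have [k [h hgen]] := fgD.
  apply: (@fin_gen_surj _ 'M[R]_(n, k) _
    (mk_linear (f := fun A : 'M[R]_(n, k) => [ffun i => \sum_j A i j *: h j]) _)).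
  - move=> a A B; apply/ffunP => i; rewrite !ffunE scaler_sumr -big_split.
    by apply: eq_bigr => j _; rewrite !mxE scalerDl scalerA.
  - move=> lin f; have [c cE] := choice (fun i => hgen (f i)).
    exists (\matrix_(i, j) c i j); apply/ffunP => i; rewrite ffunE cE.
    by apply: eq_bigr => j _; rewrite mxE.
  apply: (@fin_gen_surj _ 'rV[R]_(n * k) _ (vec_mx : {linear _ -> _})).
    by move=> A; exists (mxvec A); apply: mxvecK.
  exact: fin_gen_rv.
have ev_lin : linear (fun f : hom C D => [ffun i => hom_fun f (g i)]).
  by move=> a f f'; apply/ffunP => i; rewrite !ffunE.
apply: (fin_gen_sub R_noeth (f := mk_linear ev_lin) _ fgDn).
apply: inj_ker => f f0; apply: hom_ext => x; have [c ->] := gen x.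
rewrite /hom_fun linear_sum big1 // => i _; rewrite linearZ /=.
by have /ffunP /(_ i) := f0; rewrite !ffunE /hom_fun => ->; rewrite scaler0.
Qed.

(** Hom(C, [coz i]) need not be finitely generated, so generation is asserted modulo liftable maps.
    The proof shifts dimension: Ext^(i+1)(C) is the image of Ext^i(K) for a syzygy K. *)
Lemma ext_fin_gen i C : fin_gen C -> exists n (F : 'I_n -> hom C (coz i)),
  forall f, exists (c : 'I_n -> R) g, liftable g /\ f = \sum_k c k *: F k + g.
Proof.
elim: i C => [|i IH] C fgC.
  have [n [F gen]] := fin_gen_hom fgC N_fg; exists n, F => f.
  have [c cE] := gen f; exists c, 0; rewrite addr0; split=> //.
  by case: (liftable_submod 0 C).
have [n [K [k [p [ex fgK]]]]] := fg_presentation R_noeth fgC.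
have [r [F gen]] := IH K fgK.
(* The connecting map, together with the extension over the free module that computes it. *)
have ext (f : hom K (coz i)) : exists g : hom C (coz i.+1), exists h : {linear 'rV[R]_n -> inj_mod i.+1},
    (forall x, h (k x) = cin i (hom_fun f x)) /\ forall v, bd i.+1 (h v) = hom_fun g (p v).
  have [h hE] := inj_ext (cin i \o f) (se_inj ex).
  have [|g gE] := se_ext (f := bd i.+1 \o h) ex.
    by move=> a /=; rewrite hE /= (se_gf _ (cin_exact i)).
  by exists g, h; split=> v; [apply: hE | exact: esym (gE v)].
have [G Gh] := choice (fun j => ext (F j)); have [H GH] := choice Gh.
exists r, G => f; have [h hE] := rv_projective ((f : {linear _ -> _}) \o p) (se_surj (cin_exact i)).
have [|l lE] := se_lift (f := h \o k) (cin_exact i).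
  by move=> x /=; rewrite hE /= (se_gf _ ex) linear0.
have [c [u [[u' u'E] lsum]]] := gen l.
have [u'' u''E] := inj_ext u' (se_inj ex).
exists c; exists (f - \sum_j c j *: G j); split; last by rewrite [RHS]addrC subrK.
(* On K, the lift [h] of f agrees with [S] up to the liftable part [u]; subtracting [S] and the
   extension of [u] leaves a map that vanishes on K and descends to C. *)
pose S : {linear 'rV[R]_n -> inj_mod i.+1} := \sum_j c j *: (H j : hom _ _).
have SE v : S v = \sum_j c j *: H j v by apply: (hom_sumE (fun j => c j *: (H j : hom _ _))).
have [|g gE] := se_ext (f := (h \- S) \- (cin i \o bd i \o u'')) ex.
  move=> x /=; rewrite SE u''E u'E -[h (k x)]/((h \o k) x) -lE.
  have -> : l x = \sum_j c j *: hom_fun (F j) x + hom_fun u x.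
    rewrite -[l x]/(hom_fun (l : hom _ _) x) lsum.
    by rewrite -[LHS]/(hom_fun (\sum_j c j *: F j) x + hom_fun u x) hom_sumE.
  rewrite linearD linear_sum [X in X + _]addrC /=.
  have -> : \sum_j cin i (c j *: hom_fun (F j) x) = \sum_j c j *: H j (k x).
    by apply: eq_bigr => j _; rewrite linearZ /= (GH j).1.
  by rewrite addKr subrr.
exists g => y; have [v <-] := se_surj ex y.
transitivity (hom_fun f (p v) - \sum_j c j *: hom_fun (G j) (p v)).
  rewrite gE /= !linearB /= hE SE (se_gf _ (cin_exact i)) subr0 linear_sum.
  by congr (_ - _); apply: eq_bigr => j _; rewrite linearZ /= (GH j).2.
by rewrite -[RHS]/(hom_fun f (p v) - hom_fun (\sum_j c j *: G j) (p v)) hom_sumE.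
Qed.

(** Ext^(i+1)(D) = 0 makes multiplication by [y] surjective on Ext^i(C), to which Nakayama
    applies. *)
Lemma ext0_nakayama i C D y (g : {linear C -> D}) : fin_gen C ->
  (forall a, exists s, s * (1 - a * y) = 1) ->
  short_exact (scale_map C y) g -> ext0 i.+1 D -> ext0 i C.
Proof.
move=> fgC yu ex D0; have [n [F gen]] := ext_fin_gen i fgC.
move=> f; apply: (nakayama (y := y) (liftable_submod i C) gen yu) => {}f.
have [k kE] := ext0_extend ex D0 f; exists k, 0; split.
  by case: (liftable_submod i C).
rewrite addr0; apply: hom_ext => c; rewrite -[LHS]kE /= linearZ.
by [].
Qed.

End Coresolution.

(** * Reflexivity and the range of nonzero Ext over a Gorenstein local ring *)

Section HomFunctor.
Variable R : comNzRingType.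
Implicit Types A B C D K X Y Z : lmodType R.

Lemma post_subproof X A B (f : {linear A -> B}) :
  linear (fun g : hom X A => (f \o (g : {linear _ -> _}) : hom X B)).
Proof. by move=> a g h; apply: hom_ext => x; apply: (linearP f). Qed.
Definition post X A B (f : {linear A -> B}) : {linear hom X A -> hom X B} :=
  mk_linear (@post_subproof X A B f).

Lemma pre_subproof X A B (f : {linear A -> B}) :
  linear (fun g : hom B X => ((g : {linear _ -> _}) \o f : hom A X)).
Proof. by move=> a g h; apply: hom_ext. Qed.
Definition pre X A B (f : {linear A -> B}) : {linear hom B X -> hom A X} :=
  mk_linear (@pre_subproof X A B f).

Definition dual C := hom C (R^o : lmodType R).

Lemma eval_linear A B (x : A) : linear (fun f : hom A B => hom_fun f x).
Proof. by []. Qed.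

Lemma dual_rv_eval n (L : {linear dual 'rV[R]_n -> R^o}) :
  exists v, forall xi, L xi = hom_fun xi v.
Proof.
exists (\row_j L (row_coord R j)) => xi.
have {1}-> : xi = \sum_j (hom_fun xi (delta_mx 0 j) : R) *: (row_coord R j : dual _).
  apply: hom_ext => v; rewrite hom_sumE {1}[v]row_sum_delta /hom_fun linear_sum.
  by apply: eq_bigr => j _; rewrite linearZ; apply: mulrC.
set w := \row_j _; rewrite [in RHS](row_sum_delta w) /hom_fun !linear_sum; apply: eq_bigr => j _.
by rewrite !linearZ [w 0 j]mxE; apply: mulrC.
Qed.

Definition row_form n (v : 'rV[R]_n) : dual 'rV[R]_n :=
  rv_map (fun i => v 0 i : R^o).

Lemma dual_rv_iso n : exists f : {linear 'rV[R]_n -> dual 'rV[R]_n}, bijective f.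
Proof.
have lin : linear (@row_form n).
  move=> a u v; apply: hom_ext => w.
  rewrite -[RHS]/(a *: rv_map _ w + rv_map _ w) /hom_fun /row_form !rv_mapE.
  rewrite scaler_sumr -big_split; apply: eq_bigr => i _.
  by rewrite !mxE /= /GRing.scale /=; ring.
exists (mk_linear lin).
exists (fun xi : dual 'rV[R]_n => \row_j (hom_fun xi (delta_mx 0 j) : R)).
  move=> v; apply/rowP => j; rewrite mxE.
  exact: (@rv_map_delta R R^o n (fun i => v 0 i : R^o) j).
move=> xi; apply: hom_ext; apply: rv_lin_eq => j.
rewrite [LHS](@rv_map_delta R R^o n _ j) mxE.
by [].
Qed.

(** Lift the factorization of a through [q] to s g. Then a - s g q has image in K, and it restricts
    to a on K because q i = 0. *)
Lemma scale_id_syz n K X (i : {linear K -> 'rV[R]_n}) (q : {linear 'rV[R]_n -> X}) a :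
  short_exact i q -> a *: (idfun : hom X X) \in factors_through_free X X ->
  exists r : {linear 'rV[R]_n -> K}, forall x, r (i x) = a *: x.
Proof.
move=> ex /factors_through_freeP [l [g [h ghE]]].
have [s sE] := rv_projective h (se_surj ex).
have [|r rE] := se_lift (f := scale_map _ a \- (s \o g \o q)) ex.
  by move=> v /=; rewrite linearB sE -ghE linearZ subrr.
exists r => x; apply: (se_inj ex); rewrite rE /= (se_gf _ ex).
rewrite (linear0 g) (linear0 s) subr0.
by rewrite linearZ.
Qed.

Lemma factors_post X Y Z (f : hom X Y) (g : {linear Y -> Z}) :
  f \in factors_through_free X Y -> (g \o (f : {linear X -> Y}) : hom X Z) \in factors_through_free X Z.
Proof.
move=> /factors_through_freeP [n [u [v uv]]]; apply/factors_through_freeP.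
exists n, u, (g \o v) => x /=; exact: (congr1 g (uv x)).
Qed.

Lemma factors_pre X Y Z (f : hom X Y) (g : {linear Z -> X}) :
  f \in factors_through_free X Y -> ((f : {linear X -> Y}) \o g : hom Z Y) \in factors_through_free Z Y.
Proof.
move=> /factors_through_freeP [n [u [v uv]]]; apply/factors_through_freeP.
exists n, (u \o g), v => x /=; exact: (uv (g x)).
Qed.

Lemma rank1_fun X Y (w : Y) (xi : dual X) : linear (fun x => (hom_fun xi x : R) *: w).
Proof. by move=> a x y; rewrite /hom_fun linearP scalerDl scalerA. Qed.
Lemma rank1_linear X Y (w : Y) : linear (fun xi : dual X => mk_linear (rank1_fun w xi) : hom X Y).
Proof.
by move=> a xi eta; apply: hom_ext => x; rewrite /hom_fun /= scalerDl scalerA.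
Qed.
Definition rank1 X Y (w : Y) : {linear dual X -> hom X Y} := mk_linear (@rank1_linear X Y w).

Lemma hom_rv_decomp X n (h : hom X 'rV[R]_n) :
  h = \sum_j rank1 X (delta_mx 0 j) (post X (row_coord R j) h).
Proof.
apply: hom_ext => x; rewrite hom_sumE [LHS]row_sum_delta.
by apply: eq_bigr => j _.
Qed.

End HomFunctor.

Section GorensteinLocal.
Variables (R : comNzRingType) (m : idealr R).
Hypotheses (R_noeth : noetherian R) (R_local : is_local m).
Variable res : coresolution (R^o : lmodType R).
Implicit Types A B C D K X Y : lmodType R.

Local Notation ev := (ext0 res).

(* By finite injective dimension these are the totally reflexive modules. *)
Definition tot_refl C := fin_gen C /\ forall i, ev i.+1 C.

Lemma ev_dual_rv i n : ev i.+1 (dual 'rV[R]_n).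
Proof. by have [f /ext0_iso] := dual_rv_iso R n; apply; apply: ext0_rv. Qed.

Lemma ev_hom_rv i X n : ev i (dual X) -> ev i (hom X 'rV[R]_n).
Proof.
move=> X0 f.
have [g gE] := choice (fun j => X0 (f \o rank1 X (delta_mx 0 j))).
pose G : {linear hom X 'rV[R]_n -> inj_mod res i} :=
  \sum_j ((g j \o post X (row_coord R j)) : hom _ _).
exists G => h; rewrite [G h](hom_sumE (fun j => (g j \o post X (row_coord R j)) : hom _ _)).
rewrite {2}(hom_rv_decomp h) !linear_sum; apply: eq_bigr => j _.
exact: gE.
Qed.

Lemma dual_exact A B C (f : {linear A -> B}) (g : {linear B -> C}) :
  short_exact f g -> ev 1 C -> short_exact (pre (R^o) g) (pre (R^o) f).
Proof.
move=> ex C1; split.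
- move=> x y e; apply: hom_ext => c; have [b <-] := se_surj ex c.
  exact: (congr1 (fun h => hom_fun h b) e).
- move=> h; split=> [hf|[k <-]]; last first.
    apply: hom_ext => a; rewrite /hom_fun /= (se_gf _ ex).
    exact: linear0.
  have [|k kE] := se_ext (f := (h : {linear _ -> _})) ex.
    by move=> a; apply: (congr1 (fun h => hom_fun h a) hf).
  by exists k; apply: hom_ext.
move=> h; have [k kE] := ext0_extend (res := res) (i := 0) ex C1 h.
by exists k; apply: hom_ext.
Qed.

Lemma tot_refl_syz n K C (i : {linear K -> 'rV[R]_n}) (p : {linear 'rV[R]_n -> C}) :
  short_exact i p -> tot_refl C -> tot_refl K.
Proof.
move=> ex [fgC C1]; split; first exact: fin_gen_sub R_noeth _ _ _ (se_inj ex) (fin_gen_rv _ n).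
by move=> j; apply: (ext0_left ex) => //; apply: ext0_rv.
Qed.

(** Dualizing a presentation bounds Ext^(i+1) of the dual of C by Ext^(i+2) of the dual of its
    syzygy; repeating this leads beyond the injective dimension. *)
Lemma ev_dual C : tot_refl C -> forall i, ev i.+1 (dual C).
Proof.
move=> CT i; have [n0 large] := ext0_large res.
have [N le] : exists N, (n0 <= i.+1 + N)%N by exists n0; rewrite leq_addl.
elim: N C CT i le => [|N IH] C CT i le; first by apply: large; rewrite addn0 in le.
have [n [K [k [p [ex _]]]]] := fg_presentation R_noeth CT.1.
have KT := tot_refl_syz ex CT; have dex := dual_exact ex (CT.2 0%N).
apply: (ext0_left dex); first exact: ev_dual_rv.
by apply: IH => //; rewrite addSnnS.
Qed.

(** The functional extends to the dual of a free module above C, where every functional is an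
    evaluation. *)
Lemma refl_surj C : tot_refl C -> forall L : {linear dual C -> R^o},
  exists c, forall xi, L xi = hom_fun xi c.
Proof.
move=> CT L; have [n [K [k [p [ex _]]]]] := fg_presentation R_noeth CT.1.
have KT := tot_refl_syz ex CT; have dex := dual_exact ex (CT.2 0%N).
have [L' L'E] := ext0_extend (res := res) (i := 0) dex (@ev_dual K KT 0%N) L.
have [v vE] := dual_rv_eval L'.
by exists (p v) => xi; rewrite -L'E vE.
Qed.

(** Lift c to v in the free module. Evaluation at v vanishes on the dual of C, so it descends to the
    dual of the syzygy and is evaluation at some w there by [refl_surj]; hence v = k w maps to 0. *)
Lemma refl_inj C : tot_refl C -> forall c, (forall xi : dual C, hom_fun xi c = 0) -> c = 0.
Proof.
move=> CT c c0; have [n [K [k [p [ex _]]]]] := fg_presentation R_noeth CT.1.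
have KT := tot_refl_syz ex CT; have dex := dual_exact ex (CT.2 0%N).
have [v vE] := se_surj ex c.
have [|L LE] := se_ext (f := mk_linear (@eval_linear R _ (R^o) v)) dex.
  by move=> xi; rewrite /= /hom_fun /= vE; apply: c0.
have [w wE] := refl_surj KT L; rewrite -vE.
suff -> : v = k w by rewrite (se_gf _ ex).
apply/rowP => j; have := wE (pre (R^o) k (row_coord R j)).
by rewrite LE.
Qed.

Lemma ext_all_zero C : fin_gen C -> (forall i, ev i C) -> forall c : C, c = 0.
Proof.
move=> fgC C0 c; apply: (refl_inj (C := C)) => [|xi]; first by split.
have /ext0_hom C00 := C0 0%N; exact: C00.
Qed.

Lemma scale_quotient C y : injective (scale_map C y) ->
  exists D (g : {linear C -> D}), short_exact (scale_map C y) g /\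
    (forall d : D, y *: d = 0) /\ forall x, (forall c : C, x *: c = 0) -> forall d : D, x *: d = 0.
Proof.
move=> y_inj; have [D [g ex]] := se_of_inj y_inj; exists D, g; split=> //.
split=> [d|x xC d]; have [c <-] := se_surj ex d; rewrite -linearZ.
  exact: (se_gf c ex).
by rewrite xC linear0.
Qed.

(** * Ext of the residue field and its propagation to finitely generated modules *)

Section ResidueField.
Variables (k : lmodType R) (p : {linear R^o -> k}).
Hypotheses (p_surj : surj p) (p_ker : forall r, p r = 0 <-> r \in m).

Lemma k_fin_gen : fin_gen k. Proof. exact: fin_gen_surj p_surj (fin_gen_ro R). Qed.

Lemma k_killed y (c : k) : y \in m -> y *: c = 0.
Proof.
move=> ym; have [r <-] := p_surj c; rewrite (lin_ro p r) scalerA mulrC -scalerA -(lin_ro p y).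
by have /p_ker -> := ym; rewrite scaler0.
Qed.

Lemma ev_residue i C (q : {linear R^o -> C}) : surj q -> (forall r, q r = 0 <-> r \in m) ->
  ev i k -> ev i C.
Proof.
move=> q_surj q_ker.
have [|f fE] := lift_surj (f := q) p_surj; first by move=> a /p_ker /q_ker.
have [|g gE] := lift_surj (f := p) q_surj; first by move=> a /q_ker /p_ker.
apply: (ext0_iso (f := f)); exists g => c.
  by have [r <-] := p_surj c; rewrite fE gE.
by have [r <-] := q_surj c; rewrite gE fE.
Qed.

(** Since R/P is a domain, any y in [m] outside P is regular on C, and D is C/yC. Passing from C to
    D raises the degree by one and adds y to the annihilator. *)
Lemma ev_prime_step (P : prime_idealr R) C (q : {linear R^o -> C}) :
  surj q -> (forall r, q r = 0 <-> r \in P) ->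
  (forall r, r \in P <-> r \in m) \/
  exists y D (g : {linear C -> D}), [/\ y \in m, y \notin P, fin_gen D &
    kills (fun x => x \in P) D /\ (forall d : D, y *: d = 0) /\
    forall i, ev i.+1 D -> ev i C].
Proof.
move=> q_surj q_ker; have fgC := fin_gen_surj q_surj (fin_gen_ro R).
have [[y [ym yP]]|nex] := pselect (exists y, y \in m /\ y \notin P); [right | left]; last first.
  move=> r; split; first exact: local_le.
  by move=> rm; apply: contrapT => /negP rP; apply: nex; exists r.
have y_inj : injective (scale_map C y).
  apply: inj_ker => c; have [r <-] := q_surj c.
  have -> : scale_map C y (q r) = q (y * r) by rewrite (lin_ro q r) (lin_ro q (y * r)) /= scalerA.
  by move/q_ker; rewrite prime_idealrM (negPf yP) => /q_ker.
have [D [g [ex [yD kD]]]] := scale_quotient y_inj.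
exists y, D, g; split=> //; first exact: fin_gen_surj (se_surj ex) fgC.
split.
  move=> x d xP; apply: kD => c; have [r <-] := q_surj c.
  rewrite (lin_ro q r) scalerA mulrC -scalerA -(lin_ro q x).
  by have /q_ker -> := xP; rewrite scaler0.
split=> // i D0.
exact: ext0_nakayama R_noeth (fin_gen_ro R) _ _ _ _ _ fgC (local_unit1 R_noeth R_local ym) ex D0.
Qed.

Lemma ev_above t : (forall i, (t < i)%N -> ev i k) ->
  forall C, fin_gen C -> forall i, (t < i)%N -> ev i C.
Proof.
move=> kt C fgC.
apply: (@devissage R R_noeth (fun C => forall i, (t < i)%N -> ev i C) (fun x => x = 0)) => //.
- split=> // a x y -> ->; by rewrite scaler0 addr0.
- by move=> {fgC}C C0 i _; apply: ext0_zero.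
- by move=> A B D f g ex A0 D0 i ti; apply: (ext0_mid ex); [apply: A0 | apply: D0].
- move=> q _ {fgC}C f f_surj f_ker IH i ti.
  have [qm|[y [D [g [ym yq fgD [kD [yD step]]]]]]] := ev_prime_step f_surj f_ker.
    by apply: (ev_residue f_surj) (kt i ti) => r; rewrite f_ker qm.
  by apply: step; apply: IH => //; [exists y | apply: ltnW].
by move=> x c ->; rewrite scale0r.
Qed.

Lemma k_nonzero : p 1 <> 0.
Proof. by move/p_ker; rewrite idealr1. Qed.

Lemma ext_grade : exists t, ~ ev t k /\ forall i, (i < t)%N -> ev i k.
Proof.
have ex : exists i, `[< ~ ev i k >].
  apply: contrapT => nex; apply: k_nonzero; apply: ext_all_zero; first exact: k_fin_gen.
  by move=> i; apply: contrapT => n0; apply: nex; exists i; apply/asboolP.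
case: (ex_minnP ex) => t /asboolP tk tmin; exists t; split=> // i it.
by apply: contrapT => ik; have := tmin i; rewrite leqNgt it; move/(_ (asboolT ik)).
Qed.

(* K is the j-th syzygy of k, and B is the image in K^* of the dual of the free module that
   contains K, so that K^*/B = Ext^j(k, R). *)
Definition cosyz_chain j := exists K B (b : {linear B -> dual K}),
  [/\ fin_gen K, injective b,
      forall i, (j <= i)%N -> ev i B &
      [/\ (forall f, exists x, b x = f) <-> ev j k,
          forall y f, y \in m -> exists x, b x = y *: f,
          forall y, y \in m -> y *: (idfun : hom K K) \in factors_through_free K K &
          forall i, ev i.+1 K <-> ev (i.+1 + j) k]].

Lemma cosyz_chain0 : cosyz_chain 0.
Proof.
exists k, ('rV[R]_0 : lmodType R), \0; split.
- exact: k_fin_gen.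
- by move=> x y _; apply/rowP => -[].
- by move=> i _; apply: ext0_zero => x; apply/rowP => -[].
split.
- split=> [onto|/ext0_hom k0 f].
    by apply/ext0_hom => f c; have [x e] := onto f; rewrite -[f c]/(hom_fun (f : dual k) c) -e.
  by exists 0; apply: hom_ext => c; rewrite [RHS]k0.
- move=> y f ym; exists 0; apply: hom_ext => c.
  transitivity (hom_fun f (y *: c)); last by rewrite /hom_fun linearZ.
  by rewrite k_killed // /hom_fun (linear0 (f : {linear _ -> _})).
- move=> y ym; apply/factors_through_freeP; exists 0%N, \0, \0 => c.
  exact: (k_killed c ym).
by move=> i; rewrite addn0.
Qed.

Lemma cosyz_chainS j : ev j k -> cosyz_chain j -> cosyz_chain j.+1.
Proof.
move=> kj [K [B [b [fgK b_inj Bev [onto b_m K_m K_ev]]]]].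
have [n [K' [i [q [ex fgK']]]]] := fg_presentation R_noeth fgK.
have [B' [u [b' [u_surj b'_inj ub']]]] := image_fact (pre (R^o) i).
(* Ext^j(k, R) = 0 makes [b] bijective, so the dual of K inherits the vanishing known for B. *)
have dKev l : (j <= l)%N -> ev l (dual K).
  move=> jl; apply: (ext0_iso (f := b)); last exact: Bev.
  have [b'' b''K] := choice (onto.2 kj); exists b'' => // x.
  by apply: b_inj; rewrite b''K.
exists K', B', b'; split=> //.
  case=> // l jl; apply: (@ext0_right _ _ _ _ _ _ (pre (R^o) q) u); last exact: ev_dual_rv.
    split=> // [x y e|f].
      apply: hom_ext => c; have [v <-] := se_surj ex c.
      exact: (congr1 (fun h => hom_fun h v) e).
    split=> [uf|[x <-]]; last first.
      apply: b'_inj; rewrite ub' linear0; apply: hom_ext => c.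
      by rewrite /hom_fun /= (se_gf _ ex) linear0.
    have [|x xE] := se_ext (f := (f : {linear _ -> _})) ex.
      by move=> c; rewrite -[LHS]/(hom_fun (pre (R^o) i f) c) -ub' uf linear0.
    by exists x; apply: hom_ext.
  exact: dKev.
split.
- rewrite -[j.+1]add1n -K_ev; split=> [onto' | K1 f].
    apply: (ext0_right_of_extend ex); first exact: ext0_rv.
    move=> h; have [x xE] := onto' h; have [h' h'E] := u_surj x.
    by exists h' => c; rewrite -[RHS]/(hom_fun (h : dual K') c) -xE -h'E ub'.
  have [h hE] := ext0_extend (res := res) (i := 0) ex K1 f.
  by exists (u h); rewrite ub'; apply: hom_ext.
- move=> y f ym; have [r rE] := scale_id_syz ex (K_m y ym).
  exists (u ((f : {linear _ -> _}) \o r)); rewrite ub'; apply: hom_ext => c.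
  by rewrite /hom_fun /= rE linearZ.
- move=> y ym; have [r rE] := scale_id_syz ex (K_m y ym).
  apply/factors_through_freeP; exists n, i, r => x.
  by rewrite rE.
move=> l; rewrite -addSnnS -K_ev; split=> K0.
  by apply: (ext0_right ex) => //; apply: ext0_rv.
by apply: (ext0_left ex) => //; apply: ext0_rv.
Qed.

(* If T > t were maximal with Ext^T(k, R) <> 0, then for the module B of [cosyz_chain t] the
   nonzero quotient K^*/B would contain k and have no Ext^T, because Ext^(T-1)(B, R) = 0. *)
Lemma ext_grade_top t : ~ ev t k -> (forall i, (i < t)%N -> ev i k) ->
  forall i, (t < i)%N -> ev i k.
Proof.
move=> tk kt i0 ti0; apply: contrapT => i0k.
have [n0 large] := ext0_large res.
have bound i : `[< ~ ev i k >] -> (i <= n0)%N.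
  by move=> /asboolP nk; rewrite leqNgt; apply/negP => /ltnW /large /nk.
have ex : exists i, `[< ~ ev i k >] by exists i0; apply/asboolP.
case: (ex_maxnP ex bound) => T /asboolP Tk Tmax; apply: Tk.
have tT : (t < T)%N by apply: leq_trans ti0 (Tmax _ (asboolT i0k)).
have above C : fin_gen C -> forall i, (T < i)%N -> ev i C.
  apply: ev_above => i Ti; apply: contrapT => ik.
  by have := Tmax _ (asboolT ik); rewrite leqNgt Ti.
have chain j : (j <= t)%N -> cosyz_chain j.
  elim: j => [_|j IH jt]; first exact: cosyz_chain0.
  by apply: cosyz_chainS; [apply: kt | apply: IH; apply: ltnW].
have [K [B [b [fgK b_inj Bev [onto b_m K_m _]]]]] := chain t (leqnn t).
have [f nf] : exists f, ~ exists x, b x = f by apply/existsNP => h; apply: tk; apply/onto.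
have [E [g ex_b]] := se_of_inj b_inj.
have gf : g f <> 0 by move/(se_ker ex_b).
have fgdK : fin_gen (dual K) := fin_gen_hom R_noeth fgK (fin_gen_ro R).
(* The class of f is killed by [m], so it spans a copy of k in E. *)
have [|e eE] := lift_surj (f := elt_map (g f)) p_surj.
  move=> r /p_ker rm /=; rewrite -linearZ; have [x <-] := b_m r f rm.
  exact: se_gf ex_b.
have e_inj : injective e.
  apply: inj_ker => c; have [r <-] := p_surj c; rewrite eE /= => rg0; apply/p_ker.
  apply: contrapT => /negP /(local_unit R_noeth R_local) [s sr]; apply: gf.
  by rewrite -[g f]scale1r -sr -scalerA rg0 scaler0.
have [E' [g' ex_e]] := se_of_inj e_inj.
have fgE : fin_gen E := fin_gen_surj (se_surj ex_b) fgdK.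
apply: (ext0_left ex_e); last first.
  by apply: above => //; apply: fin_gen_surj (se_surj ex_e) fgE.
case: T tT above {Tmax} => // T tT above.
apply: (ext0_right ex_b); first exact: Bev.
(* The dual of K embeds in the dual of a free module, so its Ext is controlled by that of the
   cokernel one degree higher, above the maximal degree. *)
have [n [q q_surj]] := (fin_genP K).1 fgK.
have q_inj : injective (pre (R^o) q).
  move=> x y xy; apply: hom_ext => c; have [v <-] := q_surj c.
  exact: (congr1 (fun h => hom_fun h v) xy).
have [Y [l ex_q]] := se_of_inj q_inj.
apply: (ext0_left ex_q); first exact: ev_dual_rv.
have fgF : fin_gen (dual 'rV[R]_n) := fin_gen_hom R_noeth (fin_gen_rv R n) (fin_gen_ro R).
by apply: above => //; apply: fin_gen_surj (se_surj ex_q) fgF.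
Qed.

(** This is dim R/q <= r, recursive in r to match the induction of [ev_below]. *)
Fixpoint coheight_le r (q : prime_idealr R) : Prop := forall q' : prime_idealr R,
  (forall x, x \in q -> x \in q') -> (exists x, x \in q' /\ x \notin q) ->
  if r is r'.+1 then coheight_le r' q' else False.

(** Each prime step raises i by one, and the new element y outside q lowers the coheight bound by
    one, so i + r is preserved until only the residue field is left. *)
Lemma ev_below t : (forall i, (i < t)%N -> ev i k) ->
  forall r (a : R -> Prop), is_ideal a ->
  (forall q : prime_idealr R, (forall x, a x -> x \in q) -> coheight_le r q) ->
  forall C, fin_gen C -> kills a C -> forall i, (i + r < t)%N -> ev i C.
Proof.
move=> kt; elim=> [|r IH] a ida aq C fgC kC.
  apply: (@devissage R R_noeth (fun C => forall i, (i + 0 < t)%N -> ev i C) a) => //.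
  - by move=> {fgC kC}C C0 i _; apply: ext0_zero.
  - by move=> A B D f g ex A0 D0 i it; apply: (ext0_mid ex); [apply: A0 | apply: D0].
  move=> q qa {fgC kC}C f f_surj f_ker _ i it.
  have [qm|[y [D [g [ym yq _ _]]]]] := ev_prime_step f_surj f_ker.
    apply: (ev_residue f_surj); last by apply: kt; rewrite addn0 in it.
    by move=> r; rewrite f_ker qm.
  have [q' q'm] := local_prime R_noeth R_local.
  case: (aq q qa q') => [x /(local_le R_noeth R_local) /q'm //|].
  by exists y; split=> //; apply/q'm.
apply: (@devissage R R_noeth (fun C => forall i, (i + r.+1 < t)%N -> ev i C) a) => //.
- by move=> {fgC kC}C C0 i _; apply: ext0_zero.
- by move=> A B D f g ex A0 D0 i it; apply: (ext0_mid ex); [apply: A0 | apply: D0].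
move=> q qa {fgC kC}C f f_surj f_ker _ i it.
have [qm|[y [D [g [ym yq fgD [kD [yD step]]]]]]] := ev_prime_step f_surj f_ker.
  apply: (ev_residue f_surj); last by apply: kt; apply: leq_ltn_trans it; apply: leq_addr.
  by move=> x; rewrite f_ker qm.
apply: step; apply: (IH (fun x => forall d : D, x *: d = 0)) => //; last by rewrite addSnnS.
- split=> [d|b u v uD vD d]; first by rewrite scale0r.
  by rewrite scalerDl -scalerA uD vD scaler0 addr0.
- move=> q' q'D; apply: (aq q qa q') => [x xq|]; last by exists y; split=> //; apply: q'D.
  by apply: q'D => d; apply: kD.
Qed.

End ResidueField.
End GorensteinLocal.

(** * Depth and dimension *)

Lemma enat_sup_ge (P : nat -> Prop) n : P 0%N -> enat_le (Some n) (enat_sup P) ->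
  exists k, P k /\ (n <= k)%N.
Proof.
move=> P0 le; apply: contrapT => nex.
have lt k : P k -> (k < n)%N.
  by move=> Pk; rewrite ltnNge; apply/negP => nk; apply: nex; exists k.
have : enat_le (enat_sup P) (Some n.-1).
  by apply/enat_supP => k /lt /=; lia.
case: (enat_sup P) le => [b|] //= nb bn; have := lt _ P0; lia.
Qed.

Lemma enat_lt_le n x : enat_lt (Some n) x -> enat_le (Some n.+1) x.
Proof. by case: x => [b|] // [/= nb ne]; rewrite ltn_neqAle nb andbT; apply/eqP => e; case: ne; rewrite e. Qed.

Section Depth.
Variables (R : comNzRingType) (m : idealr R).
Implicit Types A B C D K X Y Z M : lmodType R.

Lemma in_ideal_mul_submod M (x : seq R) j : submod (@in_ideal_mul R M x j).
Proof.
split=> [|a _ _ [z ->] [w ->]].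
  by exists (fun=> 0); rewrite big1 // => i _; rewrite scaler0.
exists (fun i => a *: z i + w i); rewrite scaler_sumr -big_split.
by apply: eq_bigr => i _; rewrite scalerDr !scalerA mulrC.
Qed.

Lemma in_ideal_mulS M (x : seq R) j (y : M) :
  in_ideal_mul x j.+1 y <-> exists u v, in_ideal_mul x j u /\ y = u + x`_j *: v.
Proof.
split=> [[z ->]|[_ [v [[z ->] ->]]]].
  rewrite big_ord_recr; exists (\sum_(i < j) x`_i *: z (widen_ord (leqnSn j) i)), (z ord_max).
  by split=> //; exists (fun i => z (widen_ord (leqnSn j) i)).
exists (fun i => if unlift ord_max i is Some l then z l else v).
rewrite big_ord_recr /= unlift_none; congr (_ + _); apply: eq_bigr => i _.
have -> : widen_ord (leqnSn j) i = lift ord_max i by apply: val_inj; exact: (esym (lift_max i)).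
by rewrite liftK.
Qed.

Lemma depth_geP M n : (exists y : M, y <> 0) -> enat_le (Some n) (depth m M) ->
  exists k, (n <= k)%N /\ regular_length m M k.
Proof.
move=> [y y0]; rewrite /depth; case: asboolP => [M0|_ le]; first by case: y0.
have [|k [kP nk]] := enat_sup_ge _ le; last by exists k.
exists [::]; split=> //; split=> //; exists y => -[z]; by rewrite big_ord0.
Qed.

Lemma no_chain_coheight r (q : prime_idealr R) :
  (forall p : nat -> prime_idealr R, p 0%N = q -> ~ forall i, (i < r.+1)%N ->
    {subset p i <= p i.+1} /\ ~ {subset p i.+1 <= p i}) -> coheight_le r q.
Proof.
elim: r q => [|r IH] q nochain q' qq' [x [xq' xq]].
  apply: (nochain (fun i => if i is 0 then q else q')) => // -[|//] _; split=> //.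
  by move=> /(_ x xq'); apply/negP.
apply: IH => p p0 chain; apply: (nochain (fun i => if i is j.+1 then p j else q)) => //.
move=> [|i] //= ir; last exact: chain.
by rewrite p0; split=> // /(_ x xq'); apply/negP.
Qed.

Lemma krull_coheight d (q : prime_idealr R) : enat_le (krull_dim R) (Some d) -> coheight_le d q.
Proof.
move=> /enat_supP dim; apply: no_chain_coheight => p _ chain.
by have /= := dim d.+1 (ex_intro _ p chain); rewrite ltnn.
Qed.

Lemma quot_prime (q q' : prime_idealr R) : (forall x, x \in q -> x \in q') ->
  exists P : prime_idealr {ideal_quot q}, forall r, (\pi_{ideal_quot q} r)%qT \in P <-> r \in q'.
Proof.
move=> qq'; pose a (z : {ideal_quot q}) := repr z \in q'.
have aE r : a (\pi_{ideal_quot q} r)%qT <-> r \in q'.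
  have e : repr (\pi_{ideal_quot q} r)%qT - r \in q'.
    by apply: qq'; rewrite Quotient.idealrBE reprK.
  by rewrite /a; split=> h; [rewrite -(subrK (repr (\pi_{ideal_quot q} r)%qT) r) -opprB rpredD ?rpredN
    | rewrite -(subrK r (repr _)) rpredD].
have aP z : exists r, z = (\pi_{ideal_quot q} r)%qT by exists (repr z); rewrite reprK.
have [||z w|P PE] := @prime_of_set _ a.
- split=> [|b x y]; first by rewrite -[0](raddf0 (\pi_{ideal_quot q})%qT); apply/aE; rewrite idealr0.
  have [b' ->] := aP b; have [x' ->] := aP x; have [y' ->] := aP y.
  move=> /aE xq /aE yq; rewrite /GRing.scale /= -rmorphM -rmorphD; apply/aE.
  by rewrite rpredD // idealMr.
- by rewrite -[1](rmorph1 (\pi_{ideal_quot q})%qT) => /aE; rewrite idealr1.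
- have [z' ->] := aP z; have [w' ->] := aP w; rewrite -rmorphM => /aE.
  by rewrite prime_idealrM => /orP [] h; [left | right]; apply/aE.
by exists P => r; rewrite PE.
Qed.

Lemma W_coheight n (q : prime_idealr R) : W n q -> coheight_le n q.
Proof.
move=> /enat_supP dim; apply: no_chain_coheight => p p0 chain.
have qp i : (i <= n.+1)%N -> forall x, x \in q -> x \in p i.
  elim: i => [|i IH] ni x xq; first by rewrite p0.
  by apply: (chain i ni).1; apply: IH => //; apply: ltnW.
(* [prime_chain] wants a prime at every index; beyond n+1 the one induced by q serves as a
   default. *)
have P_ex i : exists P : prime_idealr {ideal_quot q}, (i <= n.+1)%N ->
    forall r, (\pi_{ideal_quot q} r)%qT \in P <-> r \in p i.
  have [ni|ni] := boolP (i <= n.+1)%N; first by have [P PE] := quot_prime (qp i ni); exists P.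
  by have [P _] := quot_prime (fun x (xq : x \in q) => xq); exists P.
have [P PE] := choice P_ex.
suff ch : prime_chain {ideal_quot q} n.+1 by have /= := dim _ ch; rewrite ltnn.
exists P => i ni; split.
  move=> z; rewrite -[z]reprK => /(PE i (ltnW ni)) /(chain i ni).1 h.
  exact/(PE i.+1 ni).
move=> sub; apply: (chain i ni).2 => x /(PE i.+1 ni) /sub /(PE i (ltnW ni)).
by [].
Qed.

Section Ext.
Hypotheses (R_noeth : noetherian R) (R_local : is_local m).
Variable res : coresolution (R^o : lmodType R).
Local Notation ev := (ext0 res).

(** Applied to the quotients of C by initial parts of [x]: dividing by the next element trades one
    unit of remaining length for one Ext degree, and Nakayama brings the vanishing back. *)
Lemma ev_regular t : (forall C, fin_gen C -> forall i, (t < i)%N -> ev i C) ->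
  forall C (x : seq R), fin_gen C -> (forall a, a \in x -> a \in m) -> regular_seq C x ->
  forall i, (t < i + size x)%N -> ev i C.
Proof.
move=> high C x fgC xm [x_reg _].
suff main j : forall i l, (l + j = size x)%N -> (t < i + j)%N ->
    forall (Q : lmodType R) (q : {linear C -> Q}), surj q -> (forall c, q c = 0 <-> in_ideal_mul x l c) -> ev i Q.
  move=> i ti; apply: (main _ i 0%N _ ti C idfun) => // [c|c]; first by exists c.
  split=> [c0|[z ->]]; last by rewrite big_ord0.
  by rewrite (c0 : c = 0); case: (in_ideal_mul_submod C x 0).
elim: j => [|j IH] i l lj ti Q q q_surj q_ker.
  by apply: high; [apply: fin_gen_surj q_surj fgC | rewrite addn0 in ti].
have lx : (l < size x)%N by lia.
have xl_inj : injective (scale_map Q x`_l).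
  apply: inj_ker => z; have [c <-] := q_surj z; rewrite /= -linearZ => /q_ker /(x_reg _ _ lx) /q_ker.
  by [].
have [D [g [ex _]]] := scale_quotient xl_inj.
have D0 : ev i.+1 D.
  apply: (IH i.+1 l.+1 _ _ D (g \o q)); rewrite ?addSnnS //.
    move=> d; have [z <-] := se_surj ex d; have [c <-] := q_surj z.
    by exists c.
  move=> c; rewrite in_ideal_mulS; split=> [/(se_ker ex) [z] /=|[u [v [/q_ker qu ->]]]].
    have [v <-] := q_surj z; rewrite -linearZ => e; exists (c - x`_l *: v), v.
    by rewrite subrK; split=> //; apply/q_ker; rewrite linearB e subrr.
  by rewrite /= linearD qu add0r linearZ; apply: (se_gf (q v) ex).
have xlm : x`_l \in m by apply: xm; apply: mem_nth.
exact: ext0_nakayama R_noeth (fin_gen_ro R) _ _ _ _ _ (fin_gen_surj q_surj fgC)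
  (local_unit1 R_noeth R_local xlm) ex D0.
Qed.

Definition ext_dim d :=
  (forall C, fin_gen C -> forall i, (d < i)%N -> ev i C) /\
  (forall r (a : R -> Prop), is_ideal a ->
    (forall q : prime_idealr R, (forall x, a x -> x \in q) -> coheight_le r q) ->
    forall C, fin_gen C -> kills a C -> forall i, (i + r < d)%N -> ev i C).

(** The zero module is treated apart, because its depth is infinite by convention and gives no
    regular sequence. *)
Lemma ev_depth t n : (forall C, fin_gen C -> forall i, (t < i)%N -> ev i C) ->
  forall C, fin_gen C -> enat_le (Some n) (depth m C) ->
  forall i, (t < i + n)%N -> ev i C.
Proof.
move=> high C fgC dep i ti; have [nz|C0] := pselect (exists y : C, y <> 0).
  have [k [nk [x [xk xm x_reg]]]] := depth_geP nz dep.
  by apply: (ev_regular high fgC xm x_reg); lia.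
by apply: ext0_zero => y; apply: contrapT => y0; apply: C0; exists y.
Qed.

(** Let t be the only degree in which Ext(k, R) is nonzero. If t < d, a regular sequence on M of
    length at least d kills every Ext^i(M, R), so M = 0. If d < t, then [ev_below] for the zero
    ideal gives Hom(R, R) = 0, contradicted by the identity. *)
Lemma ext_dim_of_MCM d M : krull_dim R = Some d -> MCM m M -> (exists y : M, y <> 0) ->
  ext_dim d.
Proof.
move=> dimR [fgM depM] nz.
have [k [p [p_surj p_ker]]] := quotient_exists (idealr_set m).
have [t [tk kt]] := ext_grade R_noeth res p_surj p_ker.
have kt' := @ext_grade_top _ _ R_noeth R_local res k p p_surj p_ker t tk kt.
have high := @ev_above _ _ R_noeth R_local res k p p_surj p_ker t kt'.
have low := @ev_below _ _ R_noeth R_local res k p p_surj p_ker t kt.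
have coh (q : prime_idealr R) : coheight_le d q by apply: krull_coheight; rewrite dimR /=.
suff -> : d = t by split.
apply/eqP; rewrite eqn_leq; apply/andP; split.
  rewrite dimR in depM; have [e [de [x [xe xm x_reg]]]] := depth_geP nz depM.
  apply: leq_trans de _; rewrite leqNgt; apply/negP => te.
  have [y] := nz; apply; apply: (ext_all_zero (res := res) R_noeth fgM) => i.
  by apply: (ev_regular high fgM xm x_reg); rewrite xe; lia.
rewrite leqNgt; apply/negP => dt.
have id0 : is_ideal (fun x : R => x = 0).
  by split=> // a x y -> ->; rewrite scaler0 addr0.
have k0 : kills (fun x : R => x = 0) (R^o : lmodType R).
  by move=> x c ->; rewrite scale0r.
have ev0 := low d _ id0 (fun q _ => coh q) _ (fin_gen_ro R) k0 0%N dt.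
have [g /(_ 1) /= e] := ev0 (idfun : {linear R^o -> R^o}).
by have := oner_neq0 R; rewrite -e eqxx.
Qed.

Lemma MCM_tot_refl d M : krull_dim R = Some d -> ext_dim d -> MCM m M -> tot_refl res M.
Proof.
move=> dimR [high _] [fgM]; rewrite dimR => depM; split=> // i.
by apply: (ev_depth high fgM depM); rewrite addSn ltnS leq_addl.
Qed.

End Ext.
End Depth.

(** * The annihilator of the stable endomorphism module *)

Section StableAnnihilator.
Variable R : comNzRingType.
Implicit Types A B C D K X Y Z M : lmodType R.

Lemma stable_class0 X Y : stable_class (0 : hom X Y) = 0.
Proof.
have := stable_hom_scaleE 0 (0 : hom X Y).
by rewrite !scale0r => <-.
Qed.

Lemma stable_class_eq0 X Y (f : hom X Y) : stable_class f = 0 <-> f \in factors_through_free X Y.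
Proof. by rewrite -stable_class0 stable_classP subr0. Qed.

Lemma stable_map_linear X Y : linear (@stable_class R X Y).
Proof. by move=> a f g; rewrite -stable_classD -stable_hom_scaleE. Qed.
Definition stable_map X Y : {linear hom X Y -> stable_hom X Y} := mk_linear (@stable_map_linear X Y).

Lemma stable_map_surj X Y : surj (stable_map X Y).
Proof. by move=> z; have [f ->] := stable_class_surj z; exists f. Qed.

Lemma stable_hom_zeroP X Y :
  (forall z : stable_hom X Y, z = 0) <-> forall f : hom X Y, f \in factors_through_free X Y.
Proof.
split=> [z0 f|fr z]; first exact/stable_class_eq0.
by have [f ->] := stable_class_surj z; apply/stable_class_eq0.
Qed.

Lemma factors_eq X Y (f g : hom X Y) : f \in factors_through_free X Y ->
  (forall x, hom_fun f x = hom_fun g x) -> g \in factors_through_free X Y.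
Proof. by move=> fF /hom_ext <-. Qed.

(** For X = M this is the ideal J. As a factorization statement it can be carried along syzygies in
    both directions. *)
Definition stab_ann X (a : R) := a *: (idfun : hom X X) \in factors_through_free X X.

Lemma stab_ann_ideal X : is_ideal (stab_ann X).
Proof.
split=> [|a x y Xx Xy]; rewrite /stab_ann; first by rewrite scale0r rpred0.
by rewrite scalerDl -scalerA rpredD // rpredZ.
Qed.

Lemma stab_ann_hom X Y a (f : hom X Y) : stab_ann X a -> a *: f \in factors_through_free X Y.
Proof.
move=> Xa; apply: (factors_eq (factors_post (f : {linear _ -> _}) Xa)) => x.
by rewrite -[LHS]/(hom_fun f (a *: x)) /hom_fun linearZ.
Qed.

Lemma stab_ann_kills X Y : kills (stab_ann X) (stable_hom X Y).
Proof.
move=> a z Xa; have [f ->] := stable_class_surj z.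
by rewrite stable_hom_scaleE; apply/stable_class_eq0; apply: stab_ann_hom.
Qed.

Lemma stab_ann_zero X : (forall z : stable_hom X X, z = 0) -> stab_ann X 1.
Proof. by move=> /stable_hom_zeroP X0; apply: X0. Qed.

Lemma stab_ann_killed X a : (forall z : stable_hom X X, a *: z = 0) -> stab_ann X a.
Proof. by move=> kz; apply/stable_class_eq0; rewrite -stable_hom_scaleE. Qed.

Lemma stable_iso_sym X Y : stable_iso X Y -> stable_iso Y X.
Proof. by move=> [f [g [gf fg]]]; exists g, f. Qed.

Lemma stab_ann_iso X Y a : stable_iso X Y -> stab_ann X a -> stab_ann Y a.
Proof.
move=> [f [g [_ fg]]] Xa.
have h1 := factors_pre (g : {linear _ -> _}) (factors_post (f : {linear _ -> _}) Xa).
have h2 := rpredZ a fg; rewrite /stab_ann -[_ *: _]opprK rpredN.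
apply: (factors_eq (rpredB h2 h1)) => y.
rewrite -[LHS]/(a *: (f (g y) - y) - f (a *: g y)).
by rewrite linearZ scalerBr addrAC subrr sub0r.
Qed.

Lemma stable_hom_iso_left X X' Y : stable_iso X X' ->
  (forall f : hom X Y, f \in factors_through_free X Y) ->
  forall f : hom X' Y, f \in factors_through_free X' Y.
Proof.
move=> [u [v [_ uv]]] X0 f.
have h1 := factors_pre (v : {linear _ -> _}) (X0 ((f : {linear _ -> _}) \o (u : {linear _ -> _}))).
have h2 := factors_post (f : {linear _ -> _}) uv.
apply: (factors_eq (rpredB h1 h2)) => y.
rewrite -[LHS]/(hom_fun f (u (v y)) - hom_fun f (u (v y) - y)).
by rewrite /hom_fun linearB opprB addrC subrK.
Qed.

Lemma stable_hom_iso_right X Y Y' : stable_iso Y Y' ->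
  (forall f : hom X Y, f \in factors_through_free X Y) ->
  forall f : hom X Y', f \in factors_through_free X Y'.
Proof.
move=> [u [v [_ uv]]] X0 f.
have h1 := factors_post (u : {linear _ -> _}) (X0 ((v : {linear _ -> _}) \o (f : {linear _ -> _}))).
have h2 := factors_pre (f : {linear _ -> _}) uv.
apply: (factors_eq (rpredB h1 h2)) => y.
rewrite -[LHS]/(u (v (hom_fun f y)) - (u (v (hom_fun f y)) - hom_fun f y)).
by rewrite opprB addrC subrK.
Qed.

Lemma first_syzygyP X K : first_syzygy X K <->
  exists n (i : {linear K -> 'rV[R]_n}) (p : {linear 'rV[R]_n -> X}), short_exact i p.
Proof.
split=> [[F [f [g [[n [e [e' eK e'K]]] ex]]]]|[n [i [p ex]]]]; last first.
  exists ('rV[R]_n : lmodType R), i, p; split=> //.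
  by exists n, idfun; exists id.
have e'_lin : linear e' by move=> a u v; apply: (can_inj eK); rewrite linearP !e'K.
exists n, (mk_linear e'_lin \o f), (g \o e); split.
- by move=> x y /= /(can_inj e'K) /(se_inj ex).
- move=> v /=; split=> [/(se_ker ex) [x xE]|[x <-]]; first by exists x; rewrite /= xE eK.
  by rewrite /= e'K (se_gf _ ex).
by move=> x; have [y <-] := se_surj ex x; exists (e' y); rewrite /= e'K.
Qed.

Lemma stab_ann_syz X K a : first_syzygy X K -> stab_ann X a -> stab_ann K a.
Proof.
move=> /first_syzygyP [n [i [p ex]]] Xa; have [r rE] := scale_id_syz ex Xa.
by apply/factors_through_freeP; exists n, i, r => x; rewrite rE.
Qed.

Lemma ext_row (res : coresolution (R^o : lmodType R)) A B C n
    (f : {linear A -> B}) (g : {linear B -> C}) (h : {linear A -> 'rV[R]_n}) :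
  short_exact f g -> ext0 res 1 C -> exists k : {linear B -> 'rV[R]_n}, forall x, k (f x) = h x.
Proof.
move=> ex C1.
have [k kE] := choice (fun j => ext0_extend (res := res) (i := 0) ex C1 (row_coord R j \o h)).
by exists (row_map k) => x; apply/rowP => j; rewrite mxE; apply: kE.
Qed.

(** Ext^1(X) = 0 extends the factorization of a on K to the free module above X. The difference
    between a and this extension kills K, descends to X, and composes with [p] to a since p i =
    0. *)
Lemma stab_ann_cosyz (res : coresolution (R^o : lmodType R)) X K a :
  ext0 res 1 X -> first_syzygy X K -> stab_ann K a -> stab_ann X a.
Proof.
move=> X1 /first_syzygyP [n [i [p ex]]] /factors_through_freeP [l [g [h ghE]]].
have [g' g'E] := ext_row g ex X1.
have [|r rE] := se_ext (f := scale_map _ a \- (i \o h \o g')) ex.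
  by move=> x /=; rewrite g'E -ghE linearZ subrr.
apply/factors_through_freeP; exists n, r, p => x; have [v <-] := se_surj ex x.
rewrite rE /= linearB /= (se_gf _ ex) subr0 linearZ.
by [].
Qed.

Lemma ideal_quotient (I : idealr R) :
  exists (Q : comNzRingType) (pi : {rmorphism R -> Q}), forall x, pi x = 0 <-> x \in I.
Proof.
pose pi : {rmorphism R -> {ideal_quot I}} := \pi_{ideal_quot I}%qT.
exists {ideal_quot I}, pi => x; rewrite -(rmorph0 pi) -[x in x \in I]subr0 Quotient.idealrBE.
by split=> /eqP.
Qed.

Section FreeOverLocal.
Variable m : idealr R.
Hypotheses (R_noeth : noetherian R) (R_local : is_local m).

(** Take a minimal generating family. The identity of M lifts to h' u, so e = 1 - h' u p maps into
    ker p, whose vectors have entries in [m]; thus 1 - e has unit determinant. But e is the identity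
    on ker p, which is therefore 0. *)
Lemma stab_ann1_free M : fin_gen M -> stab_ann M 1 -> is_free M.
Proof.
move=> fgM M1; pose gens n := exists g : 'I_n -> M, forall x, exists c : 'I_n -> R, x = \sum_i c i *: g i.
have ex : exists n, `[< gens n >] by have [n [g gen]] := fgM; exists n; apply/asboolP; exists g.
case: (ex_minnP ex) => n /asboolP [g gen] nmin {ex}.
pose p := rv_map g.
have p_surj : surj p.
  move=> x; have [c ->] := gen x; exists (\row_i c i); rewrite /p rv_mapE.
  by apply: eq_bigr => i _; rewrite mxE.
(* A unit entry in a relation would make one generator redundant. *)
have ker_m v i : p v = 0 -> v 0 i \in m.
  case: n => [|n] in g gen nmin p p_surj v i *; first by case: i.
  move=> pv; apply: contrapT => /negP /(local_unit R_noeth R_local) [s sv].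
  suff gn : gens n by have := nmin n (asboolT gn); rewrite ltnn.
  exists (fun j => g (lift i j)) => x; have [w <-] := p_surj x.
  pose w' := w - (w 0 i * s) *: v.
  have -> : p w = p w' by rewrite linearB linearZ_LR pv scaler0 subr0.
  exists (fun j => w' 0 (lift i j)); rewrite [LHS]rv_mapE (bigD1_ord i) //=.
  by rewrite {1}/w' !mxE -mulrA sv mulr1 subrr scale0r add0r.
move: M1 => /factors_through_freeP [l [u [h huE]]].
have [h' h'E] := rv_projective h p_surj.
pose e : {linear 'rV[R]_n -> 'rV[R]_n} := idfun \- (h' \o u \o p).
have pe v : p (e v) = 0.
  have -> : p (e v) = p v - p (h' (u (p v))) by rewrite -linearB.
  by rewrite h'E -huE -[hom_fun _ _]/(1 *: p v) scale1r subrr.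
pose E := lin1_mx e.
have Em i j : E i j \in m by rewrite mxE; apply: ker_m.
have [Q [pi piP]] := ideal_quotient m.
have piE : map_mx pi (1%:M - E) = 1%:M.
  apply/matrixP => i j; rewrite [LHS]mxE.
  have -> : (1%:M - E) i j = (i == j)%:R - E i j.
    by rewrite [LHS]mxE [X in X + _]mxE [X in _ + X]mxE.
  have /piP e0 := Em i j.
  by rewrite rmorphB e0 subr0 rmorph_nat [RHS]mxE.
have det_m : \det (1%:M - E) \notin m.
  by apply/negP => /piP; rewrite -det_map_mx piE det1; apply/eqP/oner_neq0.
have [s sdet] := local_unit R_noeth R_local det_m.
exists n, p; have p_inj : injective p.
  apply: inj_ker => v pv; have eE : e v = v.
    by rewrite -[LHS]/(v - h' (u (p v))) pv (linear0 u) (linear0 h') subr0.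
  have : v *m (1%:M - E) = 0 by rewrite mulmxBr mulmx1 mul_rV_lin1 eE subrr.
  move/(congr1 (fun z => s *: (z *m \adj (1%:M - E)))).
  by rewrite -mulmxA mul_mx_adj mul_mx_scalar scalerA sdet scale1r mul0mx scaler0.
have [q qK] := choice p_surj; exists q => // v; apply: p_inj; exact: qK.
Qed.

End FreeOverLocal.
End StableAnnihilator.

(** * Local freeness and the annihilator of the stable endomorphisms *)

Section LocallyFree.
Variables (R : comNzRingType) (p : prime_idealr R).
Implicit Types X Y M : lmodType R.
Hypothesis R_noeth : noetherian R.
Local Notation Rp := (loc_ring p).

Definition loc_elt M (x : M) : loc p M := frac x (denom1 p).
Definition loc_num (a : R) : Rp := frac (a : R^o) (denom1 p).

Lemma loc_elt_eq M (x y : M) : loc_elt x = loc_elt y <-> exists u, u \notin p /\ u *: x = u *: y.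
Proof.
rewrite fracP /=; split=> [[[u up] /= e]|[u [up e]]].
  by exists u; rewrite !mulr1 in e.
by exists (exist (fun s => s \notin p) u up); rewrite /= !mulr1.
Qed.

Lemma loc_eltD M (x y : M) : loc_elt (x + y) = loc_elt x + loc_elt y.
Proof.
rewrite /loc_elt [RHS]loc_addE; apply/fracP; exists (denom1 p) => /=.
by rewrite !scale1r !mulr1.
Qed.

Lemma loc_eltZ M a (x : M) : loc_elt (a *: x) = loc_num a *: loc_elt x.
Proof.
rewrite [RHS]frac_scaleE; apply/fracP; exists (denom1 p) => /=.
by rewrite !mulr1.
Qed.

Lemma loc_elt0 M : loc_elt (0 : M) = 0.
Proof. by []. Qed.

Lemma loc_elt_sum M (I : finType) (F : I -> M) : loc_elt (\sum_i F i) = \sum_i loc_elt (F i).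
Proof. exact: (big_morph (@loc_elt M) (@loc_eltD M) (loc_elt0 M)). Qed.

Lemma loc_numM a b : loc_num (a * b) = loc_num a * loc_num b.
Proof. exact: (loc_eltZ a (b : R^o)). Qed.
Lemma prod_denom (I : finType) (F : I -> R) :
  (forall i, F i \notin p) -> \prod_i F i \notin p.
Proof.
move=> Fp; elim/big_ind: _ => [|x y xp yp|i _]; [by rewrite idealr1 | | exact: Fp].
by rewrite prime_idealrM negb_or xp.
Qed.

Lemma common_denom M (I : finType) (z : I -> loc p M) :
  exists u (x : I -> M), u \notin p /\ forall i, loc_elt (x i) = loc_num u *: z i.
Proof.
have [x xE] := choice (fun i => frac_surj (z i)); have [s sE] := choice xE.
exists (\prod_i sval (s i)), (fun i => (\prod_(j | j != i) sval (s j)) *: x i).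
split=> [|i]; first by apply: prod_denom => i; apply: (svalP (s i)).
rewrite sE [RHS]frac_scaleE; apply/fracP; exists (denom1 p) => /=.
rewrite !mul1r scale1r scalerA; congr (_ *: _).
by rewrite [in RHS](bigD1 i).
Qed.

(** Localization commutes with Hom out of a finitely presented module: up to a denominator [u], a
    map to a free R_p-module comes from a map over R. *)
Lemma semilinear_lift M n (psi : M -> 'rV[Rp]_n) : fin_gen M ->
  (forall a x y, psi (a *: x + y) = loc_num a *: psi x + psi y) ->
  exists u (g : {linear M -> 'rV[R]_n}), u \notin p /\
    forall x j, loc_num (g x 0 j) = loc_num u * psi x 0 j.
Proof.
move=> fgM psi_lin; have [k [K [i [q [ex fgK]]]]] := fg_presentation R_noeth fgM.
have [u [a [up aE]]] := common_denom (M := R^o)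
  (fun ij : 'I_k * 'I_n => psi (q (delta_mx 0 ij.1)) 0 ij.2 : loc p R^o).
pose G := rv_map (fun i => \row_j (a (i, j) : R)).
have psi0 : psi 0 = 0.
  have := psi_lin 1 0 0; rewrite scaler0 addr0 [loc_num 1]/(1 : Rp) scale1r => e.
  by apply: (addrI (psi 0)); rewrite -e addr0.
have psi_sum (I : finType) (c : I -> R) (x : I -> M) :
    psi (\sum_i c i *: x i) = \sum_i loc_num (c i) *: psi (x i).
  elim/big_rec2: _ => // l y z _ <-.
  exact: psi_lin.
have GE v j : loc_num (G v 0 j) = loc_num u * psi (q v) 0 j.
  rewrite {2}[v]row_sum_delta linear_sum.
  have -> : \sum_l q (v 0 l *: delta_mx 0 l) = \sum_l v 0 l *: q (delta_mx 0 l).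
    by apply: eq_bigr => l _; rewrite linearZ.
  rewrite psi_sum !summxE [LHS](loc_elt_sum (M := R^o)) mulr_sumr.
  apply: eq_bigr => l _; rewrite !mxE -[loc_elt _]/(loc_num (v 0 l * a (l, j))).
  rewrite loc_numM mulrCA; congr (_ * _).
  exact: (aE (l, j)).
have [r [kap kgen]] := fgK.
have Gk l j : exists w, w \notin p /\ w * G (i (kap l)) 0 j = 0.
  have : loc_elt (G (i (kap l)) 0 j : R^o) = loc_elt (0 : R^o).
    by rewrite loc_elt0 -[LHS]/(loc_num _) GE (se_gf _ ex) psi0 mxE mulr0.
  by move/loc_elt_eq => [w [wp e]]; exists w; split=> //; rewrite [LHS]e scaler0.
have [w wE] := choice (fun lj : 'I_r * 'I_n => Gk lj.1 lj.2).
(* [G] kills the relations of M only after localization; [W] annihilates its finitely many values on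
   generators of the relations. *)
pose W := \prod_lj w lj.
have [|g gE] := se_ext (f := scale_map _ W \o G) ex.
  move=> x; have [c ->] := kgen x; rewrite !linear_sum big1 // => l _.
  rewrite !linearZ; apply/rowP => j; rewrite [RHS]mxE.
  rewrite -[LHS]/((c l *: (W *: G (i (kap l)))) 0 j) [LHS]mxE [X in _ * X]mxE.
  have [_ wG] := wE (l, j).
  rewrite /W (bigD1 (l, j)) //= -[RHS](mulr0 (c l * \prod_(lj | lj != (l, j)) w lj)) -wG /=.
  by ring.
exists (W * u), g; split=> [|x j].
  by rewrite prime_idealrM negb_or up andbT; apply: prod_denom => lj; case: (wE lj).
have [v <-] := se_surj ex x; rewrite gE /= mxE loc_numM GE loc_numM.
by rewrite mulrA.
Qed.

(** Consequently a prime containing J lies in the non-free locus. The inverse isomorphisms lift to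
    [g] and [h] with h g = t u locally, and finite generation of M lets a single [W] clear the
    difference. *)
Lemma loc_free_stab_ann M : fin_gen M -> is_free (loc p M : lmodType Rp) ->
  exists s, s \notin p /\ stab_ann M s.
Proof.
move=> fgM [n [f [f' fK f'K]]].
have f'_lin : linear f' by move=> a u v; apply: (can_inj fK); rewrite linearP !f'K.
pose psi x := f' (loc_elt (x : M)).
have [|u [g [up gE]]] := semilinear_lift (psi := psi) fgM.
  by move=> a x y; rewrite /psi loc_eltD loc_eltZ f'_lin.
have [t [y [tp yE]]] := common_denom (fun j : 'I_n => f (delta_mx 0 j)).
pose h := rv_map y.
have hgE x : loc_elt (h (g x)) = loc_elt ((t * u) *: x).
  rewrite /h rv_mapE loc_elt_sum.
  transitivity (loc_num (t * u) *: f (psi x)); last by rewrite /psi f'K -loc_eltZ.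
  rewrite [psi x]row_sum_delta linear_sum scaler_sumr; apply: eq_bigr => j _.
  rewrite loc_eltZ gE yE (linearZ_LR f (psi x 0 j)) scalerA [RHS]scalerA loc_numM; congr (_ *: _).
  by ring.
have [k [x gen]] := fgM.
have [w wE] := choice (fun i => (loc_elt_eq _ _).1 (hgE (x i))).
pose W := \prod_i w i; exists (W * (t * u)); split.
  by rewrite !prime_idealrM !negb_or tp up !andbT; apply: prod_denom => i; case: (wE i).
apply/factors_through_freeP; exists n, g, (scale_map _ W \o h) => z.
have [c ->] := gen z; rewrite /hom_fun !linear_sum; apply: eq_bigr => i _.
rewrite !linearZ; congr (_ *: _).
have [_ e] := wE i; rewrite -[RHS]/(W *: h (g (x i))) -[LHS]/((W * (t * u)) *: x i).
rewrite -[LHS]scalerA /W (bigD1 i) //= [w i * _]mulrC -[LHS]scalerA -[RHS]scalerA.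
by congr (_ *: _); rewrite -e.
Qed.

End LocallyFree.

(** * Duality for stable Hom *)

Section Trace.
Variable R : comNzRingType.
Implicit Types X Y Z : lmodType R.

Definition lin_tr n (f : {linear 'rV[R]_n -> 'rV[R]_n}) : R := \sum_j f (delta_mx 0 j) 0 j.

Lemma lin_trE n (f : {linear 'rV[R]_n -> 'rV[R]_n}) : lin_tr f = \tr (lin1_mx f).
Proof. by apply: eq_bigr => j _; rewrite mxE. Qed.

Lemma lin_tr_comm a b (f : {linear 'rV[R]_a -> 'rV[R]_b}) (g : {linear 'rV[R]_b -> 'rV[R]_a}) :
  lin_tr (g \o f) = lin_tr (f \o g).
Proof.
have comp c d (u : {linear 'rV[R]_c -> 'rV[R]_d}) (v : {linear 'rV[R]_d -> 'rV[R]_c}) :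
    lin1_mx (v \o u) = lin1_mx u *m lin1_mx v.
  by apply/row_matrixP => i; rewrite !rowE mulmxA !mul_rV_lin1.
by rewrite !lin_trE !comp mxtrace_mulC.
Qed.

Lemma lin_tr_eq n (f g : {linear 'rV[R]_n -> 'rV[R]_n}) : f =1 g -> lin_tr f = lin_tr g.
Proof. by move=> fg; apply: eq_bigr => j _; rewrite fg. Qed.

Lemma lin_tr0 n (f : {linear 'rV[R]_n -> 'rV[R]_n}) : (forall v, f v = 0) -> lin_tr f = 0.
Proof. by move=> f0; apply: big1 => j _; rewrite f0 mxE. Qed.

Lemma tr_form_linear X n (phi : {linear 'rV[R]_n -> X}) :
  linear (fun g : hom X 'rV[R]_n => lin_tr ((g : {linear _ -> _}) \o phi) : R^o).
Proof.
move=> a g h; rewrite /lin_tr scaler_sumr -big_split; apply: eq_bigr => j _ /=.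
rewrite -[LHS]/((a *: hom_fun g (phi (delta_mx 0 j)) + hom_fun h (phi (delta_mx 0 j))) 0 j).
by rewrite mxE [X in X + _]mxE.
Qed.
(** The trace pairing of Hom(F, X) with Hom(X, F), for F free. *)
Definition tr_form X n (phi : {linear 'rV[R]_n -> X}) : {linear hom X 'rV[R]_n -> R^o} :=
  mk_linear (tr_form_linear phi).

Lemma lin_tr_rank1 X n (phi : {linear 'rV[R]_n -> X}) (xi : dual X) (w : 'rV[R]_n) :
  tr_form phi (rank1 X w xi) = hom_fun xi (phi w).
Proof.
rewrite [w in RHS]row_sum_delta /hom_fun !linear_sum; apply: eq_bigr => j _.
by rewrite !linearZ /= mxE; apply: mulrC.
Qed.

End Trace.

Section Duality.
Variables (R : comNzRingType) (m : idealr R).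
Hypotheses (R_noeth : noetherian R) (R_local : is_local m).
Variable res : coresolution (R^o : lmodType R).
Implicit Types A B C D K L X Y Z M N : lmodType R.
Local Notation ev := (ext0 res).
Local Notation factors := (factors_through_free).

(** By reflexivity, L restricted to the rank-one maps with values along the j-th basis vector is
    evaluation at an element of X, and [phi] sends that basis vector there. *)
Lemma hom_rv_functional X n (L : {linear hom X 'rV[R]_n -> R^o}) : tot_refl res X ->
  exists phi : {linear 'rV[R]_n -> X}, forall g, L g = tr_form phi g.
Proof.
move=> XT.
have [x xE] := choice (fun j : 'I_n => refl_surj R_noeth XT (L \o rank1 X (delta_mx 0 j))).
exists (rv_map x) => g; rewrite {1}(hom_rv_decomp g) linear_sum; apply: eq_bigr => j _.
rewrite [LHS]xE; congr (hom_fun g _ 0 j); exact: esym (rv_map_delta x j).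
Qed.

Lemma tr_form_nondeg X n (phi : {linear 'rV[R]_n -> X}) w : tot_refl res X ->
  (forall xi, tr_form phi (rank1 X w xi) = 0) -> phi w = 0.
Proof. by move=> XT phi0; apply: (refl_inj R_noeth XT) => xi; rewrite -lin_tr_rank1. Qed.

Lemma factors_post_surj X Y n (p : {linear 'rV[R]_n -> Y}) (f : hom X Y) : surj p ->
  f \in factors X Y <-> exists g, post X p g = f.
Proof.
move=> p_surj; split=> [/factors_through_freeP [l [g [h ghE]]]|[g <-]].
  have [h' h'E] := rv_projective h p_surj; exists (h' \o g : hom _ _); apply: hom_ext => x.
  by rewrite ghE -h'E.
by apply/factors_through_freeP; exists n, g, p.
Qed.

(** The maps to Y that factor through a free module are those that lift along [p], so B is Hom(X, F)
    modulo Hom(X, K). *)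
Lemma free_maps X Y K n (i : {linear K -> 'rV[R]_n}) (p : {linear 'rV[R]_n -> Y})
    B (b : {linear B -> hom X Y}) :
  short_exact i p -> short_exact b (stable_map X Y) ->
  exists u : {linear hom X 'rV[R]_n -> B}, short_exact (post X i) u.
Proof.
move=> ex exb.
have fr f : f \in factors X Y <-> exists x, b x = f.
  by rewrite -stable_class_eq0; case: exb => _ ker _; apply: ker.
have [|u uE] := lift_inj (f := post X p) (se_inj exb).
  by move=> g; apply/fr/(factors_post_surj _ (se_surj ex)); exists g.
exists u; split.
- move=> g h e; apply: hom_ext => x; apply: (se_inj ex).
  exact: (congr1 (fun k => hom_fun k x) e).
- move=> g; split=> [ug|[h <-]]; last first.
    apply: (se_inj exb); rewrite uE linear0; apply: hom_ext => x.
    exact: (se_gf _ ex).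
  have [|h hE] := se_lift (f := (g : {linear _ -> _})) ex.
    by move=> x; rewrite -[LHS]/(hom_fun (post X p g) x) -uE ug linear0.
  by exists h; apply: hom_ext.
move=> x; have /fr /(factors_post_surj _ (se_surj ex)) [g gE] : exists y, b y = b x by exists x.
by exists g; apply: (se_inj exb); rewrite uE.
Qed.

Lemma free_maps_exists X Y : exists B (b : {linear B -> hom X Y}), short_exact b (stable_map X Y).
Proof. by have [B [b ex]] := se_of_surj (@stable_map_surj R X Y); exists B, b. Qed.

Lemma ev_hom_from_rv i Y n : ev i Y -> ev i (hom 'rV[R]_n Y).
Proof.
move=> Y0 f.
have inc_lin (j : 'I_n) : linear (fun y : Y => (elt_map y \o row_coord R j : hom 'rV[R]_n Y)).
  by move=> a x y; apply: hom_ext => v; rewrite /hom_fun /= scalerDr !scalerA mulrC.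
have [g gE] := choice (fun j => Y0 (f \o mk_linear (inc_lin j))).
pose G : {linear hom 'rV[R]_n Y -> inj_mod res i} :=
  \sum_(j < n) ((g j \o mk_linear (@eval_linear R _ Y (delta_mx 0 j))) : hom _ _).
exists G => h.
rewrite [G h](hom_sumE (fun j => (g j \o mk_linear (@eval_linear R _ Y (delta_mx 0 j))) : hom _ _)).
have {2}-> : h = \sum_j mk_linear (inc_lin j) (hom_fun h (delta_mx 0 j)).
  apply: hom_ext => v; rewrite hom_sumE {1}[v]row_sum_delta /hom_fun linear_sum.
  by apply: eq_bigr => j _; rewrite linearZ.
by rewrite !linear_sum; apply: eq_bigr => j _; apply: gE.
Qed.

(* A functional on Hom(X, Y1) restricts to tr(phi o -) on the maps through p1, with phi killing
   the kernel of p1; as stable Hom(Y1, X) = 0, phi extends from Y1 to the free module above Y,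
   and the trace form of the extension agrees with L up to a functional on stable Hom(X, Y1). *)
Lemma tr_form_extends X Y Y1 a (i0 : {linear Y1 -> 'rV[R]_a}) (p0 : {linear 'rV[R]_a -> Y})
    (L : {linear hom X Y1 -> R^o}) :
  tot_refl res X -> fin_gen Y1 -> short_exact i0 p0 -> ev 1 Y -> ev 0 (stable_hom X Y1) ->
  (forall f : hom Y1 X, f \in factors Y1 X) ->
  exists L' : {linear hom X 'rV[R]_a -> R^o}, forall u, L' (post X i0 u) = L u.
Proof.
move=> XT fgY1 ex Y_1 XY1 Y1X; have [b [p1 p1_surj]] := (fin_genP Y1).1 fgY1.
have [phi phiE] := hom_rv_functional (L \o post X p1) XT.
have phi0 w : p1 w = 0 -> phi w = 0.
  move=> pw; apply: (tr_form_nondeg XT) => xi.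
  rewrite -phiE -[LHS]/(L (post X p1 (rank1 X w xi))).
  suff -> : post X p1 (rank1 X w xi) = 0 by rewrite linear0.
  by apply: hom_ext => x; rewrite [LHS](linearZ_LR p1) pw scaler0.
have [psi psiE] := lift_surj p1_surj phi0.
have /factors_through_freeP [c [k [h khE]]] := Y1X psi.
have [k' k'E] := ext_row k ex Y_1.
pose phi' := h \o k'.
have phi'E y : phi' (i0 y) = psi y by rewrite /phi' /= k'E -khE.
exists (tr_form phi') => u; apply/eqP; rewrite -subr_eq0; apply/eqP.
have [|l lE] := lift_surj (f := (tr_form phi' \o post X i0) \- L) (@stable_map_surj R X Y1).
  move=> f /stable_class_eq0 /(factors_post_surj _ p1_surj) [g <-] /=.
  apply/eqP; rewrite subr_eq0; apply/eqP; rewrite [RHS]phiE.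
  (* Cyclicity moves the trace to the free module above Y1, where phi' i0 p1 = psi p1 = phi. *)
  rewrite [LHS](lin_tr_comm ((g : {linear _ -> _}) \o phi') (i0 \o p1)).
  by apply: lin_tr_eq => v; rewrite -[LHS]/(hom_fun g (phi' (i0 (p1 v)))) phi'E psiE.
have /ext0_hom l0 := XY1.
by rewrite -[LHS]lE l0.
Qed.
End Duality.

(** * From vanishing stable Hom to vanishing Ext of stable endomorphisms *)

Section Main.
Variables (R : comNzRingType) (m : idealr R).
Hypotheses (R_noeth : noetherian R) (R_local : is_local m).
Variable res : coresolution (R^o : lmodType R).
Implicit Types A B C D K L X Y Z M N : lmodType R.
Local Notation ev := (ext0 res).
Local Notation factors := (factors_through_free).
Variable d : nat.
Hypothesis high : forall C, fin_gen C -> forall i, (d < i)%N -> ev i C.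

(** A presentation of X exhibits Hom(X, Y) as a kernel of a map between powers of Y, so its
    Ext^(i+1) is controlled by Ext^(i+3) of a cokernel, which vanishes once i + 3 > d. *)
Lemma ev_hom X Y i : fin_gen X -> tot_refl res Y -> (d < i.+1 + 2)%N -> ev i.+1 (hom X Y).
Proof.
move=> fgX [fgY Y1] di.
have [a [K [k [p [ex fgK]]]]] := fg_presentation R_noeth fgX.
have [b [q q_surj]] := (fin_genP K).1 fgK.
have [I [u [v [u_surj v_inj uv]]]] := image_fact (pre Y (k \o q)).
have [Q [w exI]] := se_of_inj v_inj.
have exX : short_exact (pre Y p) u.
  split=> // [f g e|f].
    apply: hom_ext => x; have [z <-] := se_surj ex x.
    exact: (congr1 (fun h => hom_fun h z) e).
  split=> [uf|[g <-]]; last first.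
    apply: v_inj; rewrite uv linear0; apply: hom_ext => z.
    by rewrite /hom_fun /= (se_gf _ ex) linear0.
  have [|g gE] := se_ext (f := (f : {linear _ -> _})) ex; last by exists g; apply: hom_ext.
  move=> x; have [z <-] := q_surj x.
  by rewrite -[LHS]/(hom_fun (pre Y (k \o q) f) z) -uv uf linear0.
apply: (ext0_left exX); first exact: ev_hom_from_rv.
apply: (ext0_left exI); first exact: ev_hom_from_rv.
have fgF : fin_gen (hom 'rV[R]_b Y) := fin_gen_hom R_noeth (fin_gen_rv R b) fgY.
by apply: high; [apply: fin_gen_surj (se_surj exI) fgF | rewrite addn2 in di].
Qed.

Lemma ev_hom_rv_succ X n i : tot_refl res X -> ev i.+1 (hom X 'rV[R]_n).
Proof. by move=> XT; apply: ev_hom_rv; apply: ev_dual. Qed.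

Lemma syz_tot_refl X K : first_syzygy X K -> tot_refl res X -> tot_refl res K.
Proof. by move=> /first_syzygyP [n [i [p ex]]]; apply: tot_refl_syz ex. Qed.

(** B is Hom(X, F) modulo Hom(X, L) for the syzygy L of Y. For k = 0 the claim is that functionals
    on Hom(X, L) extend, which is [tr_form_extends]. Otherwise Hom(X, L) is filtered by its own maps
    through free modules, covered by induction, and by a stable Hom, covered by [low]. *)
Lemma ev_free_maps X k Y Z B (b : {linear B -> hom X Y}) :
  tot_refl res X -> tot_refl res Y -> syzygy k.+1 Y Z ->
  (forall f : hom Z X, f \in factors Z X) ->
  (forall Y', fin_gen Y' -> forall j, (j <= k)%N -> ev j (stable_hom X Y')) ->
  short_exact b (stable_map X Y) -> ev k.+1 B.
Proof.
move=> XT; elim: k Y B b => [|k IH] Y B b YT [L [YL LZ]] ZX low exb.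
  have LX : forall f : hom L X, f \in factors L X.
    by apply: (stable_hom_iso_left (stable_iso_sym LZ)).
  have [fgL _] := syz_tot_refl YL YT; have [n [i [p ex]]] := (first_syzygyP _ _).1 YL.
  have [u exu] := free_maps ex exb.
  apply: (ext0_right_of_extend exu); first exact: ev_hom_rv_succ.
  by move=> f; apply: (tr_form_extends R_noeth f XT fgL ex (YT.2 0%N)) => //; apply: low.
have LT := syz_tot_refl YL YT; have [n [i [p ex]]] := (first_syzygyP _ _).1 YL.
have [u exu] := free_maps ex exb; have [B' [b' exb']] := free_maps_exists X L.
apply: (ext0_right exu); last exact: ev_hom_rv_succ.
apply: (ext0_mid exb'); last by apply: low => //; case: LT.
by apply: (IH L B' b') => // Y' fgY' j jk; apply: low => //; apply: leqW.
Qed.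

Lemma ev_stable_hom X k Y Z : tot_refl res X -> tot_refl res Y -> syzygy k.+1 Y Z ->
  (forall f : hom Z X, f \in factors Z X) ->
  (forall Y', fin_gen Y' -> forall j, (j <= k)%N -> ev j (stable_hom X Y')) ->
  (d <= k.+3)%N -> ev k.+2 (stable_hom X Y).
Proof.
move=> XT YT YZ ZX low dk; have [B [b exb]] := free_maps_exists X Y.
apply: (ext0_right exb); first exact: ev_free_maps XT YT YZ ZX low exb.
by apply: ev_hom => //; [case: XT | lia].
Qed.

(** The degree 0 case of the duality, which the recursion on syzygies does not reach: a functional L
    on the stable endomorphisms of X is shown to be zero by writing it as a trace. *)
Lemma ev_stable_end0 X M : tot_refl res M -> first_syzygy M X ->
  (forall f : hom M X, f \in factors M X) -> (d <= 1)%N -> ev 0 (stable_hom X X).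
Proof.
move=> MT MX MX0 d1; have XT := syz_tot_refl MX MT.
have [a [i [p ex]]] := (first_syzygyP _ _).1 MX.
have [B [b exb]] := free_maps_exists X M; have [u exu] := free_maps ex exb.
have fgH : fin_gen (hom X M) := fin_gen_hom R_noeth XT.1 MT.1.
have fgS : fin_gen (stable_hom X M) := fin_gen_surj (@stable_map_surj R X M) fgH.
have B1 : ev 1 B.
  apply: (ext0_left exb); first by apply: ev_hom => //; [case: XT | lia].
  by apply: high => //; lia.
apply/ext0_hom => L z; have [f <-] := stable_map_surj z.
have [L' L'E] := ext0_extend (res := res) (i := 0) exu B1 (L \o stable_map X X).
have [phi phiE] := hom_rv_functional R_noeth L' XT.
have [c [q q_surj]] := (fin_genP X).1 XT.1.
(* L vanishes on endomorphisms through free modules, and the rank-one ones among them detect phi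
   i. *)
have phi0 x : phi (i x) = 0.
  have [v <-] := q_surj x; apply: (refl_inj R_noeth XT) => xi.
  rewrite -[LHS]/(hom_fun xi ((phi \o i \o q) v)) -lin_tr_rank1.
  rewrite [LHS](lin_tr_comm (i \o q) ((rank1 X v xi : {linear _ -> _}) \o phi)).
  rewrite -[LHS]/(tr_form phi (post X i (post X q (rank1 X v xi)))) -phiE L'E /=.
  have /stable_class_eq0 -> : post X q (rank1 X v xi) \in factors X X.
    by apply/(factors_post_surj _ q_surj); exists (rank1 X v xi).
  by rewrite linear0.
have [psi psiE] := se_ext ex phi0.
have /factors_through_freeP [l [k [h khE]]] := MX0 psi.
transitivity (tr_form phi (post X i f)); first by rewrite -phiE L'E.
have phiE' v : phi v = h (k (p v)) by rewrite -khE [RHS]psiE.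
transitivity (lin_tr ((i \o (f : {linear _ -> _}) \o h) \o (k \o p))).
  by apply: lin_tr_eq => v; rewrite /= phiE'.
(* After the cyclic shift the composite contains p i = 0. *)
rewrite lin_tr_comm; apply: lin_tr0 => v /=.
by rewrite (se_gf _ ex) linear0.
Qed.

Lemma syzygy_stab_ann k X Z a : tot_refl res X -> syzygy k X Z -> stab_ann X a <-> stab_ann Z a.
Proof.
elim: k X => [|k IH] X XT /=.
  by move=> XZ; split; apply: stab_ann_iso => //; apply: stable_iso_sym.
move=> [L [XL LZ]]; rewrite -(IH L (syz_tot_refl XL XT) LZ); split.
  exact: stab_ann_syz.
exact: stab_ann_cosyz (XT.2 0%N) XL.
Qed.

(* The module X is M[n-1], except for n = 1, where it is M, and n = 0, where it is Omega M. *)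
Lemma ev_stable_end n M N : tot_refl res M -> tot_refl res N -> is_shift m M (n%:Z - 1) N ->
  (forall f : hom M N, f \in factors M N) -> (d <= n.+1)%N ->
  (forall X Y, fin_gen X -> fin_gen Y -> (forall a, stab_ann M a -> stab_ann X a) ->
     forall j, (j < n)%N -> ev j (stable_hom X Y)) ->
  exists X, [/\ tot_refl res X, forall a, stab_ann M a <-> stab_ann X a &
    ev n (stable_hom X X)].
Proof.
case: n => [|[|n]] MT NT [_ sh] MN dn low.
- have [L [ML LN]] := sh; have LT := syz_tot_refl ML MT; exists L; split=> //.
    by move=> a; split; [apply: stab_ann_syz ML | apply: stab_ann_cosyz (MT.2 0%N) ML].
  apply: ev_stable_end0 ML _ dn => //; exact: stable_hom_iso_right (stable_iso_sym LN) MN.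
- exists M; split=> //; apply: ext0_zero => z.
  have /stable_hom_zeroP : forall f : hom M M, f \in factors M M.
    exact: stable_hom_iso_right sh MN.
  exact.
exists N; have Nann a : stab_ann M a <-> stab_ann N a.
  by apply: iff_sym; apply: (syzygy_stab_ann _ NT sh).
split=> //; apply: (ev_stable_hom NT NT sh MN) => // Y' fgY' j jn.
by apply: low => //; [case: NT | move=> a /Nann | lia].
Qed.

End Main.

(** * Nilpotent action of the maximal ideal *)

Section Nilpotent.
Variables (R : comNzRingType) (m : idealr R).
Hypotheses (R_noeth : noetherian R) (R_local : is_local m).
Variable res : coresolution (R^o : lmodType R).
Implicit Types A B C D Q M N : lmodType R.
Local Notation ev := (ext0 res).
Variable d : nat.
Hypothesis high : forall C, fin_gen C -> forall i, (d < i)%N -> ev i C.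

Lemma kills_sub (J : R -> Prop) A B (f : {linear A -> B}) : injective f -> kills J B -> kills J A.
Proof. by move=> f_inj kB x c Jx; apply: f_inj; rewrite linearZ linear0; apply: kB. Qed.

(* If G is the y-power torsion of C, then y is regular on C/G, so that
   Ext^i(C/G, R) = 0 for i >= d; for i < d use the Ext of C and of G. *)
Lemma nilpotent_of_ev (J : R -> Prop) C y : y \in m -> fin_gen C -> kills J C -> (0 < d)%N ->
  (forall D, fin_gen D -> kills J D -> forall i, (i.+1 < d)%N -> ev i D) ->
  (forall i, (i < d)%N -> ev i C) -> exists n, forall c : C, y ^+ n *: c = 0.
Proof.
move=> ym fgC kC d0 low Cev.
pose G (c : C) := exists n, y ^+ n *: c = 0.
have G_sub : submod G.
  split=> [|a u v [n un] [k vk]]; first by exists 0%N; rewrite scaler0.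
  exists (n + k)%N; rewrite scalerDr scalerA mulrC -scalerA exprD -[_ *: v]scalerA vk scaler0.
  by rewrite mulrC -scalerA un !scaler0 addr0.
have [A [Q [f [g [ex GA]]]]] := se_of_sub G_sub.
have y_inj : injective (scale_map Q y).
  apply: inj_ker => z; have [c <-] := se_surj ex z; rewrite /= -linearZ => /(se_ker ex) /GA [n yn].
  have /GA [x <-] : G c by exists n.+1; rewrite exprSr -scalerA.
  exact: se_gf ex.
have fgQ := fin_gen_surj (se_surj ex) fgC.
have [D [h [exD _]]] := scale_quotient y_inj.
have Qev i : ev i Q.
  have [di|id] := leqP d i.
    apply: (ext0_nakayama R_noeth (fin_gen_ro R) fgQ (local_unit1 R_noeth R_local ym) exD).
    by apply: high => //; apply: fin_gen_surj (se_surj exD) fgQ.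
  case: i id => [|i] id; first exact: ext0_quotient (se_surj ex) (Cev 0%N id).
  apply: (ext0_right ex); last exact: Cev.
  apply: low => //; first exact: fin_gen_sub R_noeth _ _ _ (se_inj ex) fgC.
  exact: kills_sub (se_inj ex) kC.
have Q0 := ext_all_zero R_noeth fgQ Qev.
have CG c : G c by apply/GA/(se_ker ex).
have [k [x gen]] := fgC; have [n nE] := choice (fun i => CG (x i)).
exists (\sum_i n i)%N => c; have [a ->] := gen c; rewrite scaler_sumr big1 // => i _.
by rewrite scalerA mulrC -scalerA (bigD1 i) //= exprD mulrC -scalerA nE !scaler0.
Qed.

End Nilpotent.

Theorem corollary5p5 (R : comNzRingType) (m : idealr R) (d : nat)
    (M N1 N2 : lmodType R)
    (R_noetherian : noetherian R) (R_local : is_local m)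
    (R_gorenstein : gorenstein R) (R_dim : krull_dim R = Some d)
    (M_MCM : MCM m M) (M_NF : forall p : prime_idealr R, NF M p -> W 1 p)
    (N1_shift : is_shift m M (d%:Z - 1) N1)
    (N2_shift : is_shift m M (d%:Z - 2) N2)
    (depth1 : enat_lt (Some 0%N) (depth m (stable_hom M N1)))
    (depth2 : enat_lt (Some 1%N) (depth m (stable_hom M N2))) :
  is_free M.
Proof.
have fgM : fin_gen M by case: M_MCM.
apply: (stab_ann1_free R_noetherian R_local fgM).
(* A nonzero maximal Cohen-Macaulay module is needed to identify [d] with the Ext degree of the
   residue field. *)
have [M0|nz] := pselect (forall x : M, x = 0).
  by apply: (factors_eq (rpred0 _)) => x; rewrite [LHS]M0 [RHS]M0.
have [r R_inj] := R_gorenstein; have [res] := coresolution_exists R_inj.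
have [high low] : ext_dim res d.
  by apply: (ext_dim_of_MCM R_noetherian R_local res R_dim M_MCM); apply/existsNP.
have MCMT N : MCM m N -> tot_refl res N.
  by move=> NM; apply: (MCM_tot_refl R_noetherian R_local R_dim _ NM).
have MT := MCMT M M_MCM; have N1T := MCMT N1 N1_shift.1; have N2T := MCMT N2 N2_shift.1.
have fgS (X Y : lmodType R) : fin_gen X -> fin_gen Y -> fin_gen (stable_hom X Y).
  move=> fgX fgY; have fgH : fin_gen (hom X Y) := fin_gen_hom R_noetherian fgX fgY.
  exact: fin_gen_surj (@stable_map_surj R X Y) fgH.
have J_ideal := stab_ann_ideal M.
have J_coh (q : prime_idealr R) : (forall x, stab_ann M x -> x \in q) -> coheight_le 1 q.
  move=> Jq; apply: W_coheight; apply: M_NF => /(loc_free_stab_ann R_noetherian fgM) [s [sq sJ]].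
  by rewrite Jq in sq.
have low1 (C : lmodType R) : fin_gen C -> kills (stab_ann M) C ->
    forall i, (i.+1 < d)%N -> ext0 res i C.
  by move=> fgC kC i id; apply: (low 1%N _ J_ideal J_coh) => //; rewrite addn1.
have J_nil y : y \in m -> (0 < d)%N -> exists n, stab_ann M (y ^+ n).
  move=> ym d0.
  have MN2 : forall f : hom M N2, f \in factors_through_free M N2.
    apply/stable_hom_zeroP; apply: (ext_all_zero (res := res) R_noetherian).
      by apply: fgS => //; case: N2T.
    move=> i; have [id|di] := ltnP i.+1 d.
      by apply: low1 id; [apply: fgS => //; case: N2T | apply: stab_ann_kills].
    (* Depth at least 2 gives the degrees i > d - 2, exactly those that [low1] misses. *)
    apply: (ev_depth R_noetherian R_local high _ (enat_lt_le depth2)).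
      by apply: fgS => //; case: N2T.
    by rewrite addn2.
  (* The duality is used with n = d - 1; the truncated predecessor is harmless since 0 < d. *)
  have sh : is_shift m M (d.-1%:Z - 1) N2.
    by have -> : d.-1%:Z - 1 = d%:Z - 2 by lia.
  have [|X Y fgX fgY MX j jd|X [XT annE Xd]] := ev_stable_end R_noetherian high MT N2T sh MN2.
  - by lia.
  - apply: low1; [exact: fgS | | lia].
    by move=> a z /MX Xa; apply: stab_ann_kills.
  have kX : kills (stab_ann M) (stable_hom X X).
    by move=> a z /annE; apply: stab_ann_kills.
  have fgX := fgS X X XT.1 XT.1.
  have [|n yn] := nilpotent_of_ev R_noetherian R_local high ym fgX kX d0 low1.
    move=> i id; have [->|ne] := eqVneq i d.-1; first exact: Xd.
    by apply: low1 => //; lia.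
  by exists n; apply/annE; apply: stab_ann_killed.
have low0 (C : lmodType R) : fin_gen C -> kills (stab_ann M) C -> forall i, (i < d)%N -> ext0 res i C.
  move=> fgC kC i id.
  apply: (low 0%N _ J_ideal _ C fgC kC); last by rewrite addn0.
  (* A prime containing J contains a power of every element of [m], so nothing lies strictly above
     it: the coheight bound drops from 1 to 0 and degree d-1 is gained. The positivity of d that
     [J_nil] asks for comes from i < d. *)
  move=> q Jq q' _ [x [xq' xq]]; move/negP: xq; apply.
  have [n /Jq] := J_nil x (local_le R_noetherian R_local xq') (leq_ltn_trans (leq0n i) id).
  elim: n => [|n IH]; first by rewrite expr0 idealr1.
  by rewrite exprS prime_idealrM => /orP [].
have MN1 : forall f : hom M N1, f \in factors_through_free M N1.
  apply/stable_hom_zeroP; apply: (ext_all_zero (res := res) R_noetherian).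
    by apply: fgS => //; case: N1T.
  move=> i; have [id|di] := ltnP i d.
    by apply: low0 id; [apply: fgS => //; case: N1T | apply: stab_ann_kills].
  (* Only i >= d is left after [low0], so depth at least 1 is enough here. *)
  apply: (ev_depth R_noetherian R_local high _ (enat_lt_le depth1)).
    by apply: fgS => //; case: N1T.
  by rewrite addn1.
have [//|X Y fgX fgY MX j jd|X [XT annE Xd]] := ev_stable_end R_noetherian high MT N1T N1_shift MN1.
  by apply: low0 => //; [exact: fgS | move=> a z /MX Xa; apply: stab_ann_kills].
apply/annE; apply: stab_ann_zero; apply: (ext_all_zero (res := res) R_noetherian).
  exact: fgS XT.1 XT.1.
move=> i; have [id|di|->] := ltngtP i d; last exact: Xd.
  by apply: low0 => //; [exact: fgS XT.1 XT.1 | move=> a z /annE; apply: stab_ann_kills].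
by apply: high di; exact: fgS XT.1 XT.1.
Qed.
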